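(* Consider the stochastic wave equation on the sphere $\partial_{tt}u(t)-\Delta_{\mathbb S^2}u(t)=\dot L(t)$ with initial values $(u(0),\partial_t u(0))=(v_1,v_2)\in[L^2(\mathbb S^2,\mathbb R)]^2$. Assume that the expected initial energy satisfies $\mathbb E[\mathcal E(0)]<\infty$ and that the mean-zero $Q$-Lévy process $L$ is trace-class. Let $(u_{1,n}^\kappa,u_{2,n}^\kappa)$ be the fully discrete approximation given by the stochastic trigonometric integrator with time step $\tau>0$. Then $$\mathbb E[\mathcal E_n^\kappa]=\mathbb E[\mathcal E_0^\kappa]+\frac{t_n}2\operatorname{Tr}(Q^\kappa)$$ for every discrete time $t_n=n\tau$ with integer $n\ge0$.
   Context: $\mathbb S^2\subset\mathbb R^3$ is the unit sphere with its surface measure, $L^2(\mathbb S^2)=L^2(\mathbb S^2,\mathbb R)$ with inner product $\langle\cdot,\cdot\rangle$ and norm $\|\cdot\|$, and $\Delta_{\mathbb S^2}$ is the Laplace--Beltrami operator. The real spherical harmonics $(Y_{\ell,m})_{\ell\ge0,\,-\ell\le m\le\ell}$ form an orthonormal basis of $L^2(\mathbb S^2)$ with $-\Delta_{\mathbb S^2}Y_{\ell,m}=\lambda_\ell Y_{\ell,m}$, $\lambda_\ell=\ell(\ell+1)$. Functions of $-\Delta_{\mathbb S^2}$ are defined by functional calculus in this basis; on the $\ell=0$ mode $(-\Delta_{\mathbb S^2})^{-1/2}\sin(t(-\Delta_{\mathbb S^2})^{1/2})$ is understood as multiplication by $t$. The initial energy is $\mathcal E(0)=\frac12\left(\|v_2\|^2+\|(-\Delta_{\mathbb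 S^2})^{1/2}v_1\|^2\right)$. $(\Omega,\mathcal F,(\mathcal F_t)_{t\ge0},\mathbb P)$ is a complete filtered probability space; $v_1,v_2$ are $\mathcal F_0$-measurable (possibly random). $L$ is a square-integrable $L^2(\mathbb S^2)$-valued Lévy process with respect to $(\mathcal F_t)$ (adapted, $L(0)=0$, stochastically continuous, stationary increments, $L(t)-L(s)$ independent of $\mathcal F_s$ for $s\le t$), with $\mathbb E[L(t)]=0$ and covariance operator $Q$ (symmetric, positive semi-definite): $\mathbb E[\langle L(t),f\rangle\langle L(t),g\rangle]=t\langle Qf,g\rangle$. ''Trace-class'' means $\operatorname{Tr}(Q)=\sum_{\ell,m}\langle QY_{\ell,m},Y_{\ell,m}\rangle<\infty$. For an integer $\kappa>0$, $\mathcal P_\kappa$ is the orthogonal projection of $L^2(\mathbb S^2)$ onto $H^\kappa=\operatorname{span}\{Y_{\ell,m}:0\le\ell\le\kappa,\,-\ell\le m\le\ell\}$, $\Delta^\kappa_{\mathbb S^2}$ is the restriction of $\Delta_{\mathbb S^2}$ to $H^\kappa$, and $Q^\kappa=\mathcal P_\kappa Q\mathcal P_\kappa$. With $t_n=n\tau$, $\Delta L_n=L(t_{n+1})-L(t_n)$ and $\Lambda_\kappa=(-\Delta^\kappa_{\mathbb S^2})^{1/2}$, the stochastic trigonometric integrator is $$u_{1,n+1}^\kappa=\cos(\tau\Lambda_\kappa)u_{1,n}^\kappa+\Lambda_\kappa^{-1}\sin(\tau\Lambda_\kappa)u_{2,n}^\kappa+\Lambda_\kappa^{-1}\sin(\tau\Lambda_\kappa)\mathcal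 P_\kappa\Delta L_n,$$ $$u_{2,n+1}^\kappa=-\Lambda_\kappa\sin(\tau\Lambda_\kappa)u_{1,n}^\kappa+\cos(\tau\Lambda_\kappa)u_{2,n}^\kappa+\cos(\tau\Lambda_\kappa)\mathcal P_\kappa\Delta L_n,$$ started at $(u_{1,0}^\kappa,u_{2,0}^\kappa)=(\mathcal P_\kappa v_1,\mathcal P_\kappa v_2)$. Its energy is $\mathcal E_n^\kappa=\frac12\left(\|u_{2,n}^\kappa\|^2+\|(-\Delta^\kappa_{\mathbb S^2})^{1/2}u_{1,n}^\kappa\|^2\right)$. *)

(* Defs.v *)
From HB Require Import structures.
From mathcomp Require Import all_boot all_order all_algebra.
From mathcomp Require Import ring_quotient.
From mathcomp Require Import complex.
From mathcomp Require Import all_classical all_reals all_analysis.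
From mathcomp Require Import measurable_realfun.
From mathcomp Require Import ring.

Set Implicit Arguments.
Unset Strict Implicit.
Unset Printing Implicit Defensive.
Import Order.TTheory GRing.Theory Num.Theory.
Import numFieldNormedType.Exports.

Local Open Scope classical_set_scope.
Local Open Scope ring_scope.
Local Open Scope quotient_scope.

(* The library's quotient [LspaceType] carries no algebraic structure, so the
   real Hilbert space L^2(mu) is built here as the quotient of the library's
   module of square-integrable functions by the a.e. null ones. *)
Section L2_space.
Context {d} {T : measurableType d} {R : realType}.
Variable mu : {measure set T -> \bar R}.

Local Notation L2fun := (LfunType mu (lee1n 2)).

Definition ae_null : {pred L2fun} :=
  fun f => `[< {ae mu, forall x, (f : T -> R) x = 0} >].

Lemma ae_null_zmod_closed : zmod_closed ae_null.
Proof.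
split; first by apply/asboolP; apply: aeW.
move=> f g /asboolP f0 /asboolP g0; apply/asboolP.
apply: filterS2 f0 g0 => x /= f0 g0.
by rewrite !fctE f0 g0 subr0.
Qed.

HB.instance Definition _ := GRing.isZmodClosed.Build L2fun ae_null
  ae_null_zmod_closed.

Definition L2 : Type := Quotient.quot ae_null.
HB.instance Definition _ := GRing.Zmodule.on L2.
HB.instance Definition _ := EqQuotient.on L2.

Lemma L2_eqP (f g : L2fun) :
  \pi_L2 f = \pi_L2 g <-> {ae mu, forall x, (f : T -> R) x = (g : T -> R) x}.
Proof.
have -> : (\pi_L2 f = \pi_L2 g) <-> f - g \in ae_null.
  by rewrite (Quotient.idealrBE ae_null); split => [->|/eqP].
by split => [/asboolP|h]; [|apply/asboolP]; [move=> h|]; apply: filterS h => x /=;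
  rewrite !fctE => /eqP; rewrite ?subr_eq0 => /eqP// ->; rewrite subrr.
Qed.

Definition L2_scale (a : R) (f : L2) : L2 := \pi_L2 (a *: repr f).

Lemma L2_scale_pi a (f : L2fun) : L2_scale a (\pi_L2 f) = \pi_L2 (a *: f).
Proof.
apply/L2_eqP; have /L2_eqP : \pi_L2 (repr (\pi_L2 f)) = \pi_L2 f by rewrite reprK.
apply: filterS => x h.
exact: (congr1 ( *%R a) h).
Qed.

Lemma L2_pi_add (f g : L2fun) : \pi_L2 (f + g) = \pi_L2 f + \pi_L2 g.
Proof. exact: (@Quotient.pi_add _ ae_null f g). Qed.

Lemma L2_scaleA a b (f : L2) :
  L2_scale a (L2_scale b f) = L2_scale (a * b) f.
Proof. by rewrite -[f](@reprK _ L2) !L2_scale_pi scalerA. Qed.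

Lemma L2_scale1 : left_id 1 L2_scale.
Proof. by move=> f; rewrite -[f]reprK L2_scale_pi scale1r. Qed.

Lemma L2_scaleDr : right_distributive L2_scale +%R.
Proof.
move=> a f g; rewrite -[f]reprK -[g]reprK.
by rewrite -L2_pi_add !L2_scale_pi scalerDr L2_pi_add.
Qed.

Lemma L2_scaleDl (f : L2) : {morph L2_scale ^~ f : a b / a + b}.
Proof. by move=> a b; rewrite -[f](@reprK _ L2) !L2_scale_pi scalerDl L2_pi_add. Qed.

HB.instance Definition _ := GRing.Zmodule_isLmodule.Build R L2
  L2_scaleA L2_scale1 L2_scaleDr L2_scaleDl.

Definition L2_inner (f g : L2) : R :=
  \int[mu]_x ((repr f : T -> R) x * (repr g : T -> R) x).

Definition L2_norm (f : L2) : R := Num.sqrt (L2_inner f f).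

Definition L2_open (A : set L2) :=
  forall f, A f -> exists2 e, 0 < e & forall g, L2_norm (g - f) < e -> A g.

Definition L2_borel : set (set L2) := <<s L2_open >>.
End L2_space.

Section sphere.
Variable R : realType.

Definition on_sphere (x : R * R * R) : bool :=
  x.1.1 ^+ 2 + x.1.2 ^+ 2 + x.2 ^+ 2 == 1.

Definition sphere_pt := {x : R * R * R | on_sphere x}.

Fact north_pole_subproof : on_sphere (0, 0, 1).
Proof. by rewrite /on_sphere /= !expr0n /= !add0r expr1n. Qed.

Definition north_pole : sphere_pt := exist _ (0, 0, 1) north_pole_subproof.

HB.instance Definition _ := SubChoice.on sphere_pt.
HB.instance Definition _ := isPointed.Build sphere_pt north_pole.

(* Borel sigma-algebra of S^2: the trace of that of R^3. *)
Definition sphere := @g_sigma_algebra_preimageType _ sphere_pt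
  (measurableTypeR R * measurableTypeR R * measurableTypeR R)%type \val.
HB.instance Definition _ := Measurable.on sphere.

Definition cylindrical (p : R * R) : sphere :=
  insubd north_pole
    (Num.sqrt (1 - p.1 ^+ 2) * cos p.2, Num.sqrt (1 - p.1 ^+ 2) * sin p.2, p.1).

Lemma measurable_cylindrical :
  measurable_fun [set: measurableTypeR R * measurableTypeR R] cylindrical.
Proof.
have m1 : measurable_fun [set: measurableTypeR R * measurableTypeR R]
   (fun p => Num.sqrt (1 - p.1 ^+ 2)).
  apply: (@measurableT_comp _ _ _ _ _ _ (@Num.sqrt R)) => /=.
    by apply: continuous_measurable_fun; exact: sqrt_continuous.
  by apply: measurable_funB => //; apply: measurable_funX.
have mx : measurable_fun [set: measurableTypeR R * measurableTypeR R]
   (fun p => Num.sqrt (1 - p.1 ^+ 2) * cos p.2).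
  apply: measurable_funM => //.
  apply: (@measurableT_comp _ _ _ _ _ _ (@cos R)) => //.
  by apply: continuous_measurable_fun; exact: continuous_cos.
have my : measurable_fun [set: measurableTypeR R * measurableTypeR R]
   (fun p => Num.sqrt (1 - p.1 ^+ 2) * sin p.2).
  apply: measurable_funM => //.
  apply: (@measurableT_comp _ _ _ _ _ _ (@sin R)) => //.
  by apply: continuous_measurable_fun; exact: continuous_sin.
pose f (p : measurableTypeR R * measurableTypeR R) : R * R * R :=
  (Num.sqrt (1 - p.1 ^+ 2) * cos p.2, Num.sqrt (1 - p.1 ^+ 2) * sin p.2, p.1).
have valf p : \val (cylindrical p) = if on_sphere (f p) then f p else (0, 0, 1).
  by rewrite /cylindrical val_insubd.
have mb : measurable_fun [set: measurableTypeR R * measurableTypeR R]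
    (fun p => on_sphere (f p)).
  apply: measurable_fun_eqr => //=.
  apply: measurable_funD; last exact: measurable_funX.
  by apply: measurable_funD; exact: measurable_funX.
have mf : measurable_fun [set: measurableTypeR R * measurableTypeR R]
    (fun p => if on_sphere (f p) then f p else (0, 0, 1)).
  apply: measurable_fun_ifT => //.
  apply: measurable_fun_pair => //; exact: measurable_fun_pair.
move=> _ _ [B mB <-]; rewrite !setTI -comp_preimage.
rewrite (_ : _ \o _ = fun p => if on_sphere (f p) then f p else (0, 0, 1)).
  by rewrite -[X in measurable X]setTI; exact: mf.
by apply/funext => p /=; rewrite valf.
Qed.

Definition cyl_domain : set (measurableTypeR R * measurableTypeR R) :=
  `[-1, 1] `*` `[0, pi *+ 2].

Lemma measurable_cyl_domain : measurable cyl_domain.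
Proof. exact: measurableX. Qed.

(* Surface measure: in the chart [cylindrical] the area element
   |d_z X x d_phi X| dz dphi of the unit sphere is dz dphi (total mass 4 pi). *)
Definition surface : set sphere -> \bar R :=
  pushforward
    (mrestr (@lebesgue_measure R \x @lebesgue_measure R)%E measurable_cyl_domain)
    cylindrical.

Let surface_push : {measure set sphere -> \bar R} :=
  measure_function_pushforward__canonical__measure_function_Measure
    (mrestr (@lebesgue_measure R \x @lebesgue_measure R)%E measurable_cyl_domain)
    measurable_cylindrical.

HB.instance Definition _ := isMeasure.Build _ sphere R surface
  (measure0 surface_push) (measure_ge0 surface_push)
  (@measure_semi_sigma_additive _ _ _ surface_push).

Let surface_fin : fin_num_fun surface.
Proof.
move=> A mA; rewrite ge0_fin_numE//.
apply: (@le_lt_trans _ _ (surface setT)).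
  by apply: le_measure => //; rewrite inE.
rewrite /surface /pushforward preimage_setT /mrestr setTI product_measure1E//.
rewrite /= !lebesgue_measure_itv/= !lte_fin.
by do 2 case: ifPn => _; rewrite ?mule0 ?mul0e -?EFinD -?EFinM ltry.
Qed.

HB.instance Definition _ := Measure_isFinite.Build _ sphere R surface surface_fin.

Definition legendre (l : nat) : {poly R} :=
  (2 ^+ l * l`!%:R)^-1 *: (('X^2 - 1) ^+ l)^`(l).

(* With (x, y, z) = (sin t cos phi, sin t sin phi, cos t) and k = |m|, the
   product P_l^(k)(z) * Re (x + i y)^k equals P_l^k(cos t) cos (k phi), where
   P_l^k is the associated Legendre function (no Condon-Shortley sign);
   Im gives sin (k phi). *)
Definition real_sph_harm (l : nat) (m : int) (x : sphere) : R :=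
  let k := `|m|%N in
  let: (x1, x2, x3) := \val x in
  let w := complex.Complex x1 x2 ^+ k in
  Num.sqrt ((l.*2.+1)%:R / (4 * pi) * ((l - k)`!%:R / (l + k)`!%:R)) *
  ((legendre l)^`(k)).[x3] *
  (if m == 0 then 1
   else Num.sqrt 2 * (if 0 < m then complex.Re w else complex.Im w)).

Let measurable_val1 : measurable_fun [set: sphere] (fun x : sphere => (\val x).1.1).
Proof.
apply: (measurableT_comp (@measurable_fst _ _ _ _)).
apply: (measurableT_comp (@measurable_fst _ _ _ _)).
by move=> _ B mB; exists B.
Qed.

Let measurable_val2 : measurable_fun [set: sphere] (fun x : sphere => (\val x).1.2).
Proof.
apply: (measurableT_comp (@measurable_snd _ _ _ _)).
apply: (measurableT_comp (@measurable_fst _ _ _ _)).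
by move=> _ B mB; exists B.
Qed.

Let measurable_val3 : measurable_fun [set: sphere] (fun x : sphere => (\val x).2).
Proof.
apply: (measurableT_comp (@measurable_snd _ _ _ _)).
by move=> _ B mB; exists B.
Qed.

Let cpow (x : sphere) k := Complex (\val x).1.1 (\val x).1.2 ^+ k.

Let cpowReS x k : complex.Re (cpow x k.+1) =
  (\val x).1.1 * complex.Re (cpow x k) - (\val x).1.2 * complex.Im (cpow x k).
Proof. by rewrite /cpow exprS; case: (_ ^+ k). Qed.

Let cpowImS x k : complex.Im (cpow x k.+1) =
  (\val x).1.1 * complex.Im (cpow x k) + (\val x).1.2 * complex.Re (cpow x k).
Proof. by rewrite /cpow exprS; case: (_ ^+ k). Qed.

Let measurable_cpow k :
  measurable_fun [set: sphere] (fun x => complex.Re (cpow x k)) /\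
  measurable_fun [set: sphere] (fun x => complex.Im (cpow x k)).
Proof.
elim: k => [|k [IH1 IH2]]; first by split; exact: measurable_cst.
split.
  under eq_fun do rewrite cpowReS.
  by apply: measurable_funB; apply: measurable_funM.
under eq_fun do rewrite cpowImS.
by apply: measurable_funD; apply: measurable_funM.
Qed.

Let cpow_le1 x k : complex.Re (cpow x k) ^+ 2 + complex.Im (cpow x k) ^+ 2 <= 1.
Proof.
have h : (\val x).1.1 ^+ 2 + (\val x).1.2 ^+ 2 <= 1.
  by rewrite -(eqP (valP x : on_sphere _)) lerDl sqr_ge0.
elim: k => [|k IH]; first by rewrite /cpow expr0 /= expr1n expr0n addr0.
rewrite cpowReS cpowImS.
move: IH; set a := complex.Re _; set b := complex.Im _ => IH.
rewrite [leLHS](_ : _ = ((\val x).1.1 ^+ 2 + (\val x).1.2 ^+ 2) * (a ^+ 2 + b ^+ 2)).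
  by apply: mulr_ile1 => //; rewrite addr_ge0 ?sqr_ge0.
by ring.
Qed.

Let real_sph_harmE l m x : real_sph_harm l m x =
  Num.sqrt ((l.*2.+1)%:R / (4 * pi) * ((l - `|m|)`!%:R / (l + `|m|)`!%:R)) *
  ((legendre l)^`(`|m|%N)).[(\val x).2] *
  (if m == 0 then 1 else Num.sqrt 2 *
    (if 0 < m then complex.Re (cpow x `|m|) else complex.Im (cpow x `|m|))).
Proof. by rewrite /real_sph_harm /cpow; case: (\val x) => -[]. Qed.

Let measurable_sph_harm l m : measurable_fun [set: sphere] (real_sph_harm l m).
Proof.
rewrite (funext (real_sph_harmE l m)).
have [mRe mIm] := measurable_cpow `|m|.
apply: measurable_funM; first apply: measurable_funM => //.
  apply: (measurableT_comp _ measurable_val3).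
  by apply: continuous_measurable_fun; exact: continuous_horner.
case: (m == 0) => //; apply: measurable_funM => //.
by case: (0 < m).
Qed.

Let bounded_sph_harm l m : exists M, forall x, `|real_sph_harm l m x| <= M.
Proof.
have [B hB] := poly_itv_bound ((legendre l)^`(`|m|%N)) (-1) 1.
eexists => x; rewrite real_sph_harmE !normrM.
apply: ler_pM; [by rewrite mulr_ge0|by []| |].
  apply: ler_wpM2l => //; apply: hB.
  have : (\val x).2 ^+ 2 <= 1.
    by rewrite -(eqP (valP x : on_sphere _)) lerDr addr_ge0 ?sqr_ge0.
  by rewrite -ler_norml -{1}(expr1n R 2) -real_normK ?num_real// ler_pXn2r ?nnegrE.
have := cpow_le1 x `|m|.
set a := complex.Re _; set b := complex.Im _ => ab.
have a1 : `|a| <= 1.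
  rewrite -(ler_pXn2r (ltn0Sn 1)) ?nnegrE// real_normK ?num_real// expr1n.
  by rewrite (le_trans _ ab)// lerDl sqr_ge0.
have b1 : `|b| <= 1.
  rewrite -(ler_pXn2r (ltn0Sn 1)) ?nnegrE// real_normK ?num_real// expr1n.
  by rewrite (le_trans _ ab)// lerDr sqr_ge0.
instantiate (1 := 1 + `|Num.sqrt 2|).
case: ifP => _; first by rewrite normr1 lerDl.
rewrite normrM (@le_trans _ _ `|Num.sqrt 2|) ?lerDr//.
by rewrite ler_piMr//; case: ifP.
Qed.

Let finite_norm_sph_harm l m : finite_norm surface 2%:E (real_sph_harm l m).
Proof.
have [M hM] := bounded_sph_harm l m.
rewrite /finite_norm unlock poweR_lty//.
rewrite (eq_integral (fun x => (`|real_sph_harm l m x| ^+ 2)%:E)); last first.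
  by move=> x _; rewrite /= powR_mulrn.
apply: (@le_lt_trans _ _ (\int[surface]_x (cst (M ^+ 2)%:E x))%E).
  apply: ge0_le_integral => //=.
  - apply/measurable_EFinP; apply: measurable_funX.
    exact: measurableT_comp.
  - by move=> x _; rewrite lee_fin ler_pXn2r ?nnegrE ?(le_trans _ (hM x)).
rewrite integral_cst//= lte_mul_pinfty ?lee_fin ?sqr_ge0//.
by rewrite -ge0_fin_numE//; exact: fin_num_measure.
Qed.

HB.instance Definition _ l m :=
  isMeasurableFun.Build _ _ sphere R (real_sph_harm l m) (measurable_sph_harm l m).
HB.instance Definition _ l m :=
  isLfunction.Build _ sphere R surface 2%:E (lee1n 2) (real_sph_harm l m)
    (finite_norm_sph_harm l m).

Definition sphY (l : nat) (m : int) : L2 surface :=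
  \pi_(L2 surface) (real_sph_harm l m : LfunType surface (lee1n 2)).

End sphere.

Arguments sphY {R} l m.

Section random_elements.
Context {dO} {Omega : measurableType dO} {R : realType} (P : probability Omega R).
Context {d} {T : measurableType d} {mu : {measure set T -> \bar R}}.
Implicit Types (F : R -> set_system Omega) (L : R -> Omega -> L2 mu).

Definition L2_measurable (G : set_system Omega) (X : Omega -> L2 mu) : Prop :=
  forall A, L2_borel A -> G (X @^-1` A).

Record complete_filtration F : Prop := {
  filtration_complete : measure_is_complete P ;
  filtration_sigma : forall t : R, 0 <= t -> sigma_algebra setT (F t) ;
  filtration_sub : forall t : R, 0 <= t -> F t `<=` measurable ;
  filtration_mono : forall s t : R, 0 <= s -> s <= t -> F s `<=` F t ;
  filtration_null : P.-negligible `<=` F 0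
}.

Definition increment L (s t : R) (w : Omega) : L2 mu := L t w - L s w.

Record sq_integrable_levy F L : Prop := {
  levy_adapted : forall t : R, 0 <= t -> L2_measurable (F t) (L t) ;
  levy_start : {ae P, forall w, L 0 w = 0} ;
  levy_stoch_cont : forall t e : R, 0 <= t -> 0 < e ->
    P [set w | e < L2_norm (increment L t s w)]
      @[s --> within [set s | 0 <= s] (nbhs t)] --> 0%E ;
  levy_stationary : forall (s t h : R) A, 0 <= s -> 0 <= t -> 0 <= h ->
    L2_borel A ->
    P (increment L s (s + h) @^-1` A) = P (increment L t (t + h) @^-1` A) ;
  levy_indep : forall (s t : R) A B, 0 <= s -> s <= t ->
    L2_borel A -> F s B ->
    P (B `&` increment L s t @^-1` A) =
    (P B * P (increment L s t @^-1` A))%E ;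
  levy_sq_integrable : forall t : R, 0 <= t ->
    (\int[P]_w (L2_norm (L t w) ^+ 2)%:E < +oo)%E
}.

(* The expectation of a square-integrable L^2-valued random element X is the
   unique vector E[X] with <E[X], f> = E[<X, f>] for all f. *)
Definition mean_zero L : Prop := forall (t : R) (f : L2 mu), 0 <= t ->
  ('E_P[fun w => L2_inner (L t w) f] = 0)%E.

Definition covariance_operator L (Q : L2 mu -> L2 mu) : Prop :=
  forall (t : R) (f g : L2 mu), 0 <= t ->
    ('E_P[fun w => (L2_inner (L t w) f * L2_inner (L t w) g)%R] =
     (t * L2_inner (Q f) g)%:E)%E.

End random_elements.

Definition L2_symmetric {d} {T : measurableType d} {R : realType}
    {mu : {measure set T -> \bar R}} (Q : L2 mu -> L2 mu) : Prop :=
  forall f g, L2_inner (Q f) g = L2_inner f (Q g).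

Definition L2_psd {d} {T : measurableType d} {R : realType}
    {mu : {measure set T -> \bar R}} (Q : L2 mu -> L2 mu) : Prop :=
  forall f, 0 <= L2_inner (Q f) f.

Section spherical_wave.
Variable R : realType.
Local Notation L2S2 := (L2 (@surface R)).

(* Position i < 2l + 1 within degree l stands for the order m = i - l. *)
Definition sphYi (l : nat) (i : 'I_(l.*2.+1)) : L2S2 := sphY l (i%:Z - l%:Z).

Definition eigenvalue (l : nat) : R := (l * l.+1)%:R.

Definition L2_trace (A : L2S2 -> L2S2) : \bar R :=
  (\sum_(0 <= l <oo) \sum_(i < l.*2.+1) (L2_inner (A (sphYi i)) (sphYi i))%:E)%E.

(* The squared norm of g(-Delta) u, infinite when u is not in the domain of
   g(-Delta). *)
Definition calculus_norm2 (g : R -> R) (u : L2S2) : \bar R :=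
  (\sum_(0 <= l <oo) \sum_(i < l.*2.+1)
     ((g (eigenvalue l) * L2_inner u (sphYi i)) ^+ 2)%:E)%E.

Definition initial_energy (v1 v2 : L2S2) : \bar R :=
  (2^-1%:E * ((L2_norm v2 ^+ 2)%:E + calculus_norm2 Num.sqrt v1))%E.

(* g(-Delta^kappa), precomposed with the orthogonal projection on H^kappa. *)
Definition calculus (kappa : nat) (g : R -> R) (u : L2S2) : L2S2 :=
  \sum_(l < kappa.+1) \sum_(i < l.*2.+1)
     (g (eigenvalue l) * L2_inner u (sphYi i)) *: sphYi i.

Definition projH (kappa : nat) : L2S2 -> L2S2 := calculus kappa (fun=> 1).

Definition truncation (kappa : nat) (Q : L2S2 -> L2S2) (u : L2S2) : L2S2 :=
  projH kappa (Q (projH kappa u)).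

Definition Lambda (kappa : nat) : L2S2 -> L2S2 := calculus kappa Num.sqrt.

Definition cosL (kappa : nat) (tau : R) : L2S2 -> L2S2 :=
  calculus kappa (fun x => cos (tau * Num.sqrt x)).

Definition LsinL (kappa : nat) (tau : R) : L2S2 -> L2S2 :=
  calculus kappa (fun x => Num.sqrt x * sin (tau * Num.sqrt x)).

(* Lambda^-1 sin(tau Lambda), read as multiplication by tau on the kernel of
   Delta. *)
Definition sincL (kappa : nat) (tau : R) : L2S2 -> L2S2 :=
  calculus kappa (fun x =>
    if x == 0 then tau else (Num.sqrt x)^-1 * sin (tau * Num.sqrt x)).

Definition trig_step (kappa : nat) (tau : R) (u : L2S2 * L2S2) (dL : L2S2) :
    L2S2 * L2S2 :=
  (cosL kappa tau u.1 + sincL kappa tau u.2 + sincL kappa tau (projH kappa dL),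
   - LsinL kappa tau u.1 + cosL kappa tau u.2 + cosL kappa tau (projH kappa dL)).

Definition discrete_energy (kappa : nat) (u : L2S2 * L2S2) : R :=
  2^-1 * (L2_norm u.2 ^+ 2 + L2_norm (Lambda kappa u.1) ^+ 2).

Section integrator.
Context {Omega : Type} (kappa : nat) (tau : R) (v1 v2 : Omega -> L2S2)
  (L : R -> Omega -> L2S2).

Fixpoint trig_integrator (n : nat) (w : Omega) : L2S2 * L2S2 :=
  if n is k.+1 then
    trig_step kappa tau (trig_integrator k w)
      (L (k.+1%:R * tau) w - L (k%:R * tau) w)
  else (projH kappa (v1 w), projH kappa (v2 w)).

End integrator.
End spherical_wave.

(* Main.v *)
From HB Require Import structures.
Require Import Defs.
From mathcomp Require Import all_boot all_order all_algebra.
From mathcomp Require Import all_classical all_reals all_analysis.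
From mathcomp Require Import measurable_realfun complex.
From mathcomp Require Import ring lra zify.

(** The energy splits over the spherical harmonics. Let Y be one of degree
    l <= kappa, with eigenvalue lambda, and follow the amplitude
    a = sqrt lambda <u_1, Y> and the velocity b = <u_2, Y>. One step of the
    integrator first adds the increment beta = <L(t + tau) - L(t), Y> to b
    and then rotates the pair (a, b) by the angle tau sqrt lambda
    ([trig_step_amplitude], [trig_step_velocity]). Rotations preserve
    a^2 + b^2, so that a step adds exactly 2 b beta + beta^2 to it
    ([trig_step_mode_energy]). At time t the velocity b is measurable with
    respect to the past, while beta is centred and independent of the past:
    the cross term has zero expectation ([levy_increment_orthogonal]), and
    beta^2 has expectation tau <Q Y, Y> ([levy_increment_variance]).
    Induction on the number of steps gives the linear growth of the
    expected energy of a mode ([expected_mode_energy]), and the sum over the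
    modes of degree at most kappa is the trace of Q^kappa
    ([truncation_trace]).

    Reading the energy off the modes is Parseval's identity in H^kappa, so
    it rests on the orthonormality of the concrete spherical harmonics
    ([sphY_orthonormal]). In the coordinates height and longitude the
    surface measure is a plane Lebesgue measure and a harmonic is a function
    of the height times a function of the longitude. Fubini's theorem
    reduces its inner products to integrals of products of cosines over a
    full turn ([azimuth_inner]) and of k-th derivatives of Legendre
    polynomials against the weight (1 - z^2)^k ([legendre_inner]); the
    latter follow from Rodrigues' formula by repeated integration by parts.

    The vanishing of the cross term is the product rule for expectations of
    independent variables ([expectationM_indep]), again Fubini's theorem
    once the joint law is recognised as a product measure. It needs square
    integrability, which [mode_adapted] carries through the steps from the
    finite expected initial energy and the covariance of L. *)

Set Implicit Arguments.
Unset Strict Implicit.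
Unset Printing Implicit Defensive.
Import Order.TTheory GRing.Theory Num.Theory.
Import numFieldNormedType.Exports.
Local Open Scope classical_set_scope.
Local Open Scope ring_scope.

(** * Legendre polynomials on the interval from -1 to 1 *)

(** A derivative lowers the order of a zero by at most one. This is what kills
    the boundary terms when Rodrigues' formula is integrated by parts. *)
Lemma root_derivn_exp (K : fieldType) (p q : {poly K}) m k (x : K) :
  (k < m)%N -> root q x -> q ^+ m %| p -> root p^`(k) x.
Proof.
move=> km qx qp; suff : q ^+ (m - k) %| p^`(k).
  move/dvdpP=> [r ->]; rewrite /root hornerM horner_exp (eqP qx).
  by rewrite expr0n subn_eq0 leqNgt km mulr0.
elim: k km {qx} => [|k IHk] km; first by rewrite subn0 derivn0.
rewrite derivnS; have /dvdpP[r ->] := IHk (ltnW km).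
have -> : (m - k = (m - k.+1).+1)%N by lia.
rewrite derivM deriv_exp exprS /= mulrA.
apply: dvdp_add; first exact: dvdp_mulIr.
by rewrite mulrnAr -mulrnAl mulrA mulrC dvdp_mulIl.
Qed.

Lemma coefM_top (K : nzRingType) (p q : {poly K}) a b :
  (size p <= a.+1)%N -> (size q <= b.+1)%N ->
  (p * q)`_(a + b) = p`_a * q`_b.
Proof.
move=> pa qb; rewrite coefM (bigD1 (inord a))//= inordK ?ltnS ?leq_addr//.
rewrite addKn big1 ?addr0// => i ia.
have [ai|] := ltnP a i; first by rewrite nth_default ?mul0r// (leq_trans pa).
rewrite leq_eqVlt => /orP[/eqP ai|ai].
  by case/eqP: ia; apply/val_inj; rewrite /= inordK// ltnS leq_addr.
by rewrite (nth_default _ (_ : size q <= _)%N) ?mulr0// (leq_trans qb)//; lia.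
Qed.

Lemma derivn_top (K : nzRingType) (p : {poly K}) n :
  (size p <= n.+1)%N -> p^`(n) = (p`_n *+ n`!)%:P.
Proof.
move=> pn; apply/polyP => -[|i]; rewrite coef_derivn coefC /=.
  by rewrite addn0 ffactnn.
by rewrite nth_default ?mul0rn// (leq_trans pn)//; lia.
Qed.

Section legendre_integrals.
Variable R : realType.
Implicit Types (p q : {poly R}) (f F : R -> R).
Local Notation leb := (@lebesgue_measure R).

Lemma continuous_itv_integrable f (a b : R) : continuous f ->
  leb.-integrable `[a, b] (EFin \o f).
Proof.
move=> cf; apply: continuous_compact_integrable; first exact: segment_compact.
by apply: continuous_subspaceT.
Qed.

Lemma Rintegral_antiderivative f F (a b : R) : a < b -> continuous f ->
  (forall x, is_derive (x : R) (1 : R) F (f x)) ->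
  Rintegral leb `[a, b] f = F b - F a.
Proof.
move=> ab cf dF; rewrite /Rintegral (continuous_FTC2 ab (F := F)) //.
- exact: continuous_subspaceT.
- have cF x : {for x, continuous F}.
    by apply: differentiable_continuous; apply/derivable1_diffP.
  split=> [x _| |]; first by case: (dF x).
  + exact/cvg_at_right_filter/cF.
  + exact/cvg_at_left_filter/cF.
- by move=> x _; rewrite derive1E; case: (dF x).
Qed.

Definition poly_integral p : R := \int[leb]_(x in `[-1, 1]) p.[x].

Lemma poly_integral_deriv p : poly_integral p^`() = p.[1] - p.[-1].
Proof.
apply: Rintegral_antiderivative; first by lra.
exact: continuous_horner.
Qed.

Lemma poly_integral_linear (a : R) p q :
  poly_integral (a *: p + q) = a * poly_integral p + poly_integral q.
Proof.
rewrite /poly_integral -RintegralZl//;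
  last exact/continuous_itv_integrable/continuous_horner.
rewrite -RintegralD//.
- by apply: eq_Rintegral => x _; rewrite hornerD hornerZ.
- apply: continuous_itv_integrable => x.
  by apply: cvgM; [exact: cvg_cst|exact: continuous_horner].
- exact/continuous_itv_integrable/continuous_horner.
Qed.

HB.instance Definition _ :=
  GRing.isLinear.Build R {poly R} R _ poly_integral poly_integral_linear.

Lemma poly_integral_by_parts p q : p.[1] * q.[1] = 0 -> p.[-1] * q.[-1] = 0 ->
  poly_integral (p * q^`()) = - poly_integral (p^`() * q).
Proof.
move=> p1 pN1; apply/eqP; rewrite -addr_eq0 addrC -raddfD/= -derivM.
by rewrite poly_integral_deriv !hornerM p1 pN1 subrr.
Qed.

(** The hypothesis is the vanishing of the n boundary terms, one for each way
    to share n - 1 derivatives between p and q. *)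
Lemma poly_integral_by_partsn n p q :
  (forall j, (j < n)%N -> forall x, x = 1 \/ x = -1 ->
    (p^`(j)).[x] * (q^`(n - j.+1)).[x] = 0) ->
  poly_integral (p * q^`(n)) = (-1) ^+ n * poly_integral (p^`(n) * q).
Proof.
elim: n p q => [|n IHn] p q b0; first by rewrite expr0 mul1r !derivn0.
rewrite derivnS poly_integral_by_parts; first last.
- by have := b0 0%N isT (-1) (or_intror erefl); rewrite derivn0 subSS subn0.
- by have := b0 0%N isT 1 (or_introl erefl); rewrite derivn0 subSS subn0.
rewrite IHn; first by rewrite exprS mulN1r mulNr derivSn.
by move=> j jn x x1; rewrite -derivSn -subSS b0.
Qed.

(** Rodrigues' formula writes the Legendre polynomial of degree l as a
    multiple of the l-th derivative of the l-th power of this polynomial. *)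
Definition rodrigues_base : {poly R} := 'X^2 - 1.

Local Notation w := rodrigues_base.

Lemma size_rodrigues_base : size w = 3%N.
Proof. exact: size_XnsubC. Qed.

Lemma monic_rodrigues_base : w \is monic. Proof. exact: monicXnsubC. Qed.

Lemma size_rodrigues n : size (w ^+ n) = n.*2.+1.
Proof.
have := size_exp w n; rewrite size_rodrigues_base /= => h.
have : size (w ^+ n) != 0%N.
  by rewrite size_poly_eq0 monic_neq0// monic_exp// monic_rodrigues_base.
by move: h; case: size => //= m -> _; lia.
Qed.

Lemma size_derivn_rodrigues l k : (size ((w ^+ l)^`(l + k)) <= (l - k).+1)%N.
Proof.
apply/leq_sizeP => j lj; rewrite coef_derivn nth_default ?mul0rn//.
by rewrite size_rodrigues; lia.
Qed.

(** The polynomial X (X^2 - 1)^(l + 1) vanishes at both endpoints, so that its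
    derivative has integral zero. *)
Lemma poly_integral_rodrigues_rec l :
  l.*2.+3%:R * poly_integral (w ^+ l.+1) =
  - l.+1.*2%:R * poly_integral (w ^+ l).
Proof.
have d : ('X * w ^+ l.+1)^`() = l.*2.+3%:R *: w ^+ l.+1 + l.+1.*2%:R *: w ^+ l.
  rewrite derivM derivX deriv_exp /= [in w^`()]/rodrigues_base.
  rewrite derivB derivXn derivC subr0 /=.
  rewrite exprS; move: (w ^+ l) => u.
  rewrite /rodrigues_base -!mul_polyC !polyC_natr -[_ *+ l.+1]mulr_natl.
  have -> : l.*2.+3 = (l + l + 3)%N by lia.
  have -> : l.+1.*2 = (l + l + 2)%N by lia.
  have -> : l.+1 = (l + 1)%N by lia.
  rewrite !natrD; ring.
have b0 (x : R) : x ^+ 2 = 1 -> ('X * w ^+ l.+1).[x] = 0.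
  move=> x2; rewrite hornerM horner_exp /rodrigues_base !hornerE x2.
  by rewrite subrr expr0n mulr0.
have := poly_integral_deriv ('X * w ^+ l.+1); rewrite d linearD !linearZ.
rewrite !b0 ?sqrrN ?expr1n// subrr => /eqP.
by rewrite addr_eq0 mulNr => /eqP.
Qed.

Lemma poly_integral_rodrigues l : poly_integral (w ^+ l) =
  (-1) ^+ l * 2 ^+ l.*2.+1 * (l`! ^ 2)%:R / (l.*2.+1)`!%:R.
Proof.
elim: l => [|l IHl].
  rewrite expr0 -derivX poly_integral_deriv !hornerX /= double0 (factS 0) fact0.
  by rewrite expr0 expr1 mul1r divr1; ring.
have n0 k : k.+1%:R != 0 :> R by rewrite pnatr_eq0.
apply: (mulfI (n0 l.*2.+2)); rewrite poly_integral_rodrigues_rec IHl.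
rewrite doubleS !factS !exprS !natrX !natrM.
have -> : l.*2.+2%:R = 2 * l.+1%:R :> R by rewrite -natrM; congr _%:R; lia.
have nf k : k`!%:R != 0 :> R by rewrite pnatr_eq0 -lt0n fact_gt0.
by field; rewrite nf !nat1r -natrD !pnatr_eq0.
Qed.

(** Integrating by parts l' + k times moves all derivatives of the second
    factor onto the product of the other two, whose degree is at most l + k.
    Nothing is left when l < l'; when l = l' there remains (l + k)! times the
    coefficient of degree l + k. *)
Lemma rodrigues_inner k l l' : (k <= l)%N -> (l <= l')%N ->
  poly_integral ((w ^+ l)^`(l + k) * (w ^+ l')^`(l' + k) * w ^+ k) =
  if l == l' then (-1) ^+ (l + k) * (((l + k)`! * (l.*2)`!)%:R / (l - k)`!%:R)
                  * poly_integral (w ^+ l) else 0.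
Proof.
move=> kl ll'; rewrite mulrAC.
have rw (x : R) : x = 1 \/ x = -1 -> root w x.
  by rewrite /root /rodrigues_base !hornerE => -[]->; rewrite ?sqrrN expr1n subrr.
set p := _ * w ^+ k.
have ps : (size p <= (l + k).+1)%N.
  rewrite (leq_trans (size_polyMleq _ _))// size_rodrigues.
  by have := size_derivn_rodrigues l k; lia.
rewrite poly_integral_by_partsn; last first.
  move=> j jl x /rw wx.
  (* For j < k the factor w ^+ k still vanishes after j derivatives; for j >=
     k fewer than l' derivatives are left on w ^+ l'. *)
  have [jk|kj] := ltnP j k.
    by rewrite (eqP (root_derivn_exp jk wx _)) ?mul0r// dvdp_mulIr.
  rewrite [X in _ * X](eqP (root_derivn_exp _ wx (dvdpp (w ^+ l')))) ?mulr0//.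
  by lia.
have [ll|] := eqVneq l l'; last first.
  move=> nll; rewrite (_ : p^`(_) = 0) ?mul0r ?raddf0 ?mulr0//.
  by apply: derivn_poly0; rewrite (leq_trans ps)//; lia.
rewrite -ll derivn_top// mul_polyC linearZ /= mulrA.
have -> : p`_(l + k) = (l.*2)`!%:R / (l - k)`!%:R.
  have -> : (l + k = (l - k) + k.*2)%N by lia.
  rewrite coefM_top ?size_rodrigues ?size_derivn_rodrigues//.
  have top m : (w ^+ m)`_m.*2 = 1.
    have /monicP := monic_exp m monic_rodrigues_base.
    by rewrite /lead_coef size_rodrigues.
  rewrite top mulr1 coef_derivn.
  have -> : (l + k + (l - k) = l.*2)%N by lia.
  have lk0 : (l - k)`!%:R != 0 :> R by rewrite pnatr_eq0 -lt0n fact_gt0.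
  apply: (mulIf lk0); rewrite divfK// top -natrM.
  have -> : (l - k = l.*2 - (l + k))%N by lia.
  by rewrite ffact_fact//; lia.
rewrite -mulr_natr natrM; congr (_ * _); ring.
Qed.

(** An associated Legendre function of order k is the k-th derivative of a
    Legendre polynomial times (1 - X^2)^(k / 2), whence the weight. *)
Lemma legendre_inner k l l' : (k <= l)%N -> (k <= l')%N ->
  poly_integral ((legendre R l)^`(k) * (legendre R l')^`(k) * (1 - 'X^2) ^+ k) =
  if l == l' then 2 / l.*2.+1%:R * ((l + k)`!%:R / (l - k)`!%:R) else 0.
Proof.
have nf m : m`!%:R != 0 :> R by rewrite pnatr_eq0 -lt0n fact_gt0.
have derivn_add p m n : p^`(m)^`(n) = p^`(m + n).
  by elim: n => [|n IHn]; rewrite ?addn0 ?derivn0// addnS !derivnS IHn.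
have -> : (1 - 'X^2) ^+ k = (-1) ^+ k *: w ^+ k.
  by rewrite -mul_polyC rmorphXn rmorphN1 -exprNn opprB.
wlog ll' : l l' / (l <= l')%N => [hw|].
  case: (leqP l l') => [|/ltnW] ll' kl kl'; first exact: hw.
  rewrite [_^`(k) * _]mulrC hw//.
  by rewrite eq_sym; case: eqVneq => // ->.
move=> kl kl'; rewrite /legendre !derivnZ !derivn_add -!/rodrigues_base.
rewrite -!(@scalerAl R {poly R}, @scalerAr R {poly R}) !linearZ /=.
rewrite rodrigues_inner//; case: eqP => [<-{ll' kl' l'}|]; last by rewrite !mulr0.
have -> : (-1) ^+ (l + k) = (-1) ^+ l * (-1) ^+ k :> R by rewrite exprD.
have -> : ((l + k)`! * (l.*2)`!)%:R = (l + k)`!%:R * (l.*2)`!%:R :> R.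
  by rewrite natrM.
have f2 : (l.*2.+1)`!%:R = l.*2.+1%:R * (l.*2)`!%:R :> R by rewrite factS natrM.
rewrite poly_integral_rodrigues f2 natrX -addnn exprS exprD.
have s2 n : (-1) ^+ n * (-1) ^+ n = 1 :> R by rewrite -expr2 sqrr_sign.
have n0 : (l + l).+1%:R != 0 :> R by rewrite pnatr_eq0.
have e0 : 2 ^+ l != 0 :> R by rewrite expf_neq0// pnatr_eq0.
(* The signs (-1) ^+ k and (-1) ^+ l both occur twice. *)
have alg (s t e f A B C D : R) : s * s = 1 -> t * t = 1 ->
    e != 0 -> f != 0 -> B != 0 -> C != 0 -> D != 0 ->
    s * ((e * f)^-1 * ((e * f)^-1 * (t * s * (A * B / C) *
      (t * (2 * (e * e)) * f ^+ 2 / (D * B))))) = 2 / D * (A / C).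
  move=> ss tt *; transitivity ((s * s) * (t * t) * (2 / D * (A / C))).
    by field; exact/and5P.
  by rewrite ss tt !mul1r.
exact: alg.
Qed.
End legendre_integrals.

(** * Trigonometric functions over a full turn *)

Section trigonometric_integrals.
Variable R : realType.
Local Notation leb := (@lebesgue_measure R).

Lemma continuous_affine_cos (a b c : R) :
  continuous (fun x : R => a * cos (b * x - c)).
Proof.
move=> x; apply: cvgM; first exact: cvg_cst.
apply: (@continuous_comp _ _ _ (fun x => b * x - c) cos);
  last exact: continuous_cos.
apply: cvgB; last exact: cvg_cst.
by apply: cvgM; [exact: cvg_cst|exact: cvg_id].
Qed.

Lemma pi2_gt0 : 0 < pi *+ 2 :> R.
Proof. by rewrite pmulrn_lgt0// pi_gt0. Qed.

(** The phase c covers sines and cosines at once. *)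
Lemma Rintegral_cos (j : int) (c : R) :
  \int[leb]_(x in `[0, pi *+ 2]) cos (j%:~R * x - c) =
  if j == 0 then pi *+ 2 * cos c else 0.
Proof.
have cf : continuous (fun x : R => cos (j%:~R * x - c)).
  have := @continuous_affine_cos 1 j%:~R c.
  by under eq_fun do rewrite mul1r.
move: cf; have [->|j0] := eqVneq j 0 => cf.
  have dF (x : R) :
      is_derive x (1 : R) (fun x => cos c * x) (cos (0%:~R * x - c)).
    rewrite mul0r sub0r cosN.
    have := is_deriveZ (cos c) (is_derive_id (x : R) (1 : R)).
    by rewrite /GRing.scale/= mulr1.
  by rewrite (Rintegral_antiderivative pi2_gt0 cf dF) mulr0 subr0 mulrC.
have jr0 : j%:~R != 0 :> R by rewrite intr_eq0.
have dF (x : R) : is_derive x (1 : R) (fun x => j%:~R^-1 * sin (j%:~R * x - c))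
    (cos (j%:~R * x - c)).
  have d1 : is_derive x (1 : R) (fun x : R => j%:~R * x - c) j%:~R.
    have := is_deriveB (is_deriveZ (j%:~R : R) (is_derive_id (x : R) (1 : R)))
      (is_derive_cst c x 1).
    by rewrite /GRing.scale/= mulr1 subr0.
  apply: (is_derive_eq
    (is_deriveZ (j%:~R^-1) (is_derive1_comp (is_derive_sin _) d1))).
  by rewrite /GRing.scale/= mulrC mulfK.
rewrite (Rintegral_antiderivative pi2_gt0 cf dF) mulr0 sub0r -mulrBr.
(* Both ends of the interval give the same value, by periodicity. *)
have sinz (i : int) x : sin (x + i%:~R * (pi *+ 2)) = sin x :> R.
  case: i => n; rewrite ?NegzE ?mulrNz -?pmulrn ?mulNr mulr_natl.
    by rewrite (periodicn (@sinD2pi R)).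
  by rewrite -[in RHS](subrK ((pi *+ 2) *+ n.+1) x) (periodicn (@sinD2pi R)).
by rewrite [_ * _ - c]addrC sinz subrr mulr0.
Qed.

(** The longitude factor of the real harmonics of order m. The sine of the
    negative orders is written as a cosine delayed by a quarter turn, so that
    products of two factors obey a single formula. *)
Definition azimuth (m : int) (x : R) : R :=
  if m == 0 then 1
  else Num.sqrt 2 * cos (`|m|%N%:R * x - (if 0 < m then 0 else pi / 2)).

Lemma continuous_azimuth m : continuous (azimuth m).
Proof.
rewrite /azimuth; case: (m == 0); first exact: cst_continuous.
exact: continuous_affine_cos.
Qed.

(** The product of two cosines is half the sum of the cosines of the
    difference and of the sum of their arguments, and only a constant survives
    integration over a full turn. For m' = - m that constant is the cosine of
    a quarter turn. *)
Lemma azimuth_inner (m m' : int) :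
  \int[leb]_(x in `[0, pi *+ 2]) (azimuth m x * azimuth m' x) =
  if m == m' then pi *+ 2 else 0.
Proof.
have z0 k c : (0 < k)%N -> \int[leb]_(x in `[0, pi *+ 2])
    (Num.sqrt 2 * cos (k%:R * x - c)) = 0 :> R.
  move=> k0; rewrite RintegralZl//.
    have := Rintegral_cos k%:Z c; rewrite -pmulrn => ->.
    by rewrite eqz_nat -[(k == 0%N)]negbK -lt0n k0 mulr0.
  apply: continuous_itv_integrable.
  have := @continuous_affine_cos 1 k%:R c.
  by under eq_fun do rewrite mul1r.
have [m0|m0] := boolP (m == 0); have [m'0|m'0] := boolP (m' == 0).
- have c1 : continuous (cst 1 : R -> R) by exact: cst_continuous.
  rewrite (eqP m0) (eqP m'0) eqxx.
  under eq_Rintegral do rewrite /azimuth eqxx mulr1.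
  by rewrite (Rintegral_antiderivative pi2_gt0 c1 (F := id)) subr0.
- rewrite (eqP m0) eq_sym (negPf m'0) /azimuth eqxx (negPf m'0).
  under eq_Rintegral do rewrite mul1r.
  by rewrite z0// absz_gt0.
- rewrite (eqP m'0) (negPf m0) /azimuth eqxx (negPf m0).
  under eq_Rintegral do rewrite mulr1.
  by rewrite z0// absz_gt0.
rewrite /azimuth (negPf m0) (negPf m'0).
set c := (if 0 < m then _ else _); set c' := (if _ then _ else _).
set k := `|m|%N; set k' := `|m'|%N.
have k0 : (0 < k)%N by rewrite absz_gt0.
have cE x :
    Num.sqrt 2 * cos (k%:R * x - c) * (Num.sqrt 2 * cos (k'%:R * x - c')) =
    cos ((k%:Z - k'%:Z)%:~R * x - (c - c')) +
    cos ((k + k')%:Z%:~R * x - (c + c')) :> R.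
  have -> : (k%:Z - k'%:Z)%:~R * x - (c - c') =
    (k%:R * x - c) - (k'%:R * x - c') :> R by rewrite intrB -!pmulrn; ring.
  have -> : (k + k')%:Z%:~R * x - (c + c') =
    (k%:R * x - c) + (k'%:R * x - c') :> R by rewrite -!pmulrn natrD; ring.
  move: (_ - c) (_ - c') => a b.
  rewrite cosB cosD mulrACA -expr2 sqr_sqrtr//; ring.
under eq_Rintegral do rewrite cE.
have ci (j : int) (b : R) :
    leb.-integrable `[0, pi *+ 2] (EFin \o (fun x : R => cos (j%:~R * x - b))).
  apply: continuous_itv_integrable.
  have := @continuous_affine_cos 1 j%:~R b.
  by under eq_fun do rewrite mul1r.
rewrite RintegralD// !Rintegral_cos.
have -> : ((k + k')%:Z == 0) = false by apply/negbTE; lia.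
rewrite addr0 subr_eq0 eqz_nat.
have [mm'|mm'] := eqVneq m m'.
  by rewrite /c /c' /k /k' mm' eqxx subrr cos0 mulr1.
case: eqP => // kk; suff -> : cos (c - c') = 0 :> R by rewrite mulr0.
(* The orders are now opposite, so that one phase is 0 and the other one is a
   quarter turn. *)
have : (0 < m) != (0 < m').
  apply: contra mm' => /eqP mm; apply/eqP; move: kk mm; rewrite /k /k'; lia.
by rewrite /c /c'; case: (0 < m); case: (0 < m') => // _;
  rewrite ?subr0 ?sub0r ?cosN cos_pihalf.
Qed.
End trigonometric_integrals.

(** * Integrals over products and restrictions *)

Section product_integral.
Context d1 d2 (T1 : measurableType d1) (T2 : measurableType d2) (R : realType).
Variable m1 : {sigma_finite_measure set T1 -> \bar R}.
Variable m2 : {sigma_finite_measure set T2 -> \bar R}.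
Variables (f : T1 -> R) (g : T2 -> R).
Hypothesis fi : m1.-integrable setT (EFin \o f).
Hypothesis gi : m2.-integrable setT (EFin \o g).

Lemma integrable_tensor :
  (m1 \x m2)%E.-integrable setT (fun z => (f z.1 * g z.2)%:E).
Proof.
have /measurable_EFinP mf := measurable_int _ fi.
have /measurable_EFinP mg := measurable_int _ gi.
apply/integrable12ltyP.
  apply/measurable_EFinP; apply: measurable_funM.
    exact: measurableT_comp.
  exact: measurableT_comp.
have /integrableP[_ fy] := fi; have /integrableP[_ gy] := gi.
rewrite (eq_integral (fun x => `|f x|%:E * \int[m2]_y `|g y|%:E)%E).
  rewrite ge0_integralZr//; last exact: integral_ge0.
    by rewrite lte_mul_pinfty// ?integral_ge0// ge0_fin_numE// integral_ge0.
  by apply/measurable_EFinP; exact: measurableT_comp.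
move=> x _; rewrite -ge0_integralZl//.
  by apply: eq_integral => y _; rewrite /= normrM EFinM.
by apply/measurable_EFinP; exact: measurableT_comp.
Qed.

Lemma integral_tensor :
  (\int[m1 \x m2]_z (f z.1 * g z.2)%:E =
   \int[m1]_x (f x)%:E * \int[m2]_y (g y)%:E)%E.
Proof.
rewrite -integral12_prod_meas1; last exact: integrable_tensor.
have gfin : (\int[m2]_y (g y)%:E)%E \is a fin_num by exact: integrable_fin_num.
rewrite -(fineK gfin) -integralZr//.
apply: eq_integral => x _; rewrite /fubini_F fineK//=.
by under eq_integral do rewrite EFinM; rewrite integralZl.
Qed.
End product_integral.

Section restricted_measure.
Local Open Scope ereal_scope.
Context d (T : measurableType d) (R : realType).
Variables (mu : {measure set T -> \bar R}) (D : set T) (mD : measurable D).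

Lemma integral_mrestr (f : T -> \bar R) : (mrestr mu mD).-integrable setT f ->
  \int[mrestr mu mD]_x f x = \int[mu]_(x in D) f x.
Proof.
move=> fi; rewrite (@negligible_integral _ _ _ (mrestr mu mD) setT (~` D))//.
- rewrite setTD setCK; apply: eq_measure_integral => A mA AD.
  by rewrite /= /mrestr (setIidl AD).
- exact: measurableC.
- by rewrite /= /mrestr setICl measure0.
Qed.
End restricted_measure.

(** The integral of a nonnegative function is the supremum of the integrals of
    the simple functions below it, and a larger function has more of them. *)
Lemma integral_mono d (T : measurableType d) (R : realType)
    (mu : {measure set T -> \bar R}) (f g : T -> \bar R) :
  (forall x, (0 <= f x)%E) -> (forall x, (f x <= g x)%E) ->
  (\int[mu]_x f x <= \int[mu]_x g x)%E.
Proof.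
move=> f0 fg; rewrite !ge0_integralTE//; last by move=> x; exact: le_trans (fg x).
apply: le_ereal_sup => _ [h hf <-]; exists h => // x; exact: le_trans (fg x).
Qed.

(** * The inner product of L^2 *)

Section L2_inner_product.
Context {d} {T : measurableType d} {R : realType}.
Variable mu : {measure set T -> \bar R}.
Local Notation L2fun := (LfunType mu (lee1n 2)).
Local Open Scope quotient_scope.
Implicit Types (f g h : L2 mu).

Lemma L2fun_mul_integrable (f g : L2fun) :
  mu.-integrable setT (EFin \o (fun x => f x * g x)).
Proof. by apply/Lfun1_integrable; apply: Lfun2_mul_Lfun1; exact: LfunP. Qed.

(** Changing representatives alters the product on a null set only. *)
Lemma L2_inner_pi (f g : L2fun) :
  L2_inner (\pi_(L2 mu) f) (\pi_(L2 mu) g) = \int[mu]_x (f x * g x).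
Proof.
rewrite /L2_inner /Rintegral; congr fine; apply: ae_eq_integral => //.
- exact: measurable_int (L2fun_mul_integrable _ _).
- exact: measurable_int (L2fun_mul_integrable _ _).
have reprE (k : L2fun) : {ae mu, forall x, (repr (\pi_(L2 mu) k) : T -> R) x = k x}.
  by apply/L2_eqP; rewrite reprK.
by apply: filterS2 (reprE f) (reprE g) => x /= -> ->.
Qed.

Lemma L2_innerC f g : L2_inner f g = L2_inner g f.
Proof. by rewrite /L2_inner; under eq_Rintegral do rewrite mulrC. Qed.

Lemma L2_inner_linear h : linear_for *%R (fun f => L2_inner f h).
Proof.
move=> a f g; rewrite -[f]reprK -[g]reprK -[h]reprK.
have -> : a *: \pi_(L2 mu) (repr f) + \pi_(L2 mu) (repr g) =
  \pi_(L2 mu) (a *: repr f + repr g) :> L2 mu.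
  by rewrite L2_pi_add; congr (_ + _); exact: L2_scale_pi.
rewrite !L2_inner_pi -RintegralZl//; last exact: L2fun_mul_integrable.
rewrite -RintegralD//.
- by apply: eq_Rintegral => x _; rewrite mulrA -mulrDl.
- have := L2fun_mul_integrable (a *: repr f) (repr h).
  by congr (_.-integrable _ _); apply/funext => x /=; rewrite -mulrA.
- exact: L2fun_mul_integrable.
Qed.

Lemma L2_innerZl a f h : L2_inner (a *: f) h = a * L2_inner f h.
Proof.
have z : L2_inner 0 h = 0.
  by have := L2_inner_linear h (-1) h h; rewrite scaleN1r addNr mulN1r addNr.
by have := L2_inner_linear h a f 0; rewrite !addr0 z addr0.
Qed.

Lemma L2_innerDl f g h : L2_inner (f + g) h = L2_inner f h + L2_inner g h.
Proof. by have := L2_inner_linear h 1 f g; rewrite scale1r mul1r. Qed.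

Lemma L2_innerNl f h : L2_inner (- f) h = - L2_inner f h.
Proof. by rewrite -scaleN1r L2_innerZl mulN1r. Qed.

Lemma L2_innerBl f g h : L2_inner (f - g) h = L2_inner f h - L2_inner g h.
Proof. by rewrite L2_innerDl L2_innerNl. Qed.

Lemma L2_inner_suml (I : Type) (r : seq I) (F : I -> L2 mu) h :
  L2_inner (\sum_(i <- r) F i) h = \sum_(i <- r) L2_inner (F i) h.
Proof.
elim/big_rec2: _ => [|i x f _ <-]; last exact: L2_innerDl.
by rewrite -(scale0r h) L2_innerZl mul0r.
Qed.

Lemma L2_inner_ge0 f : 0 <= L2_inner f f.
Proof. by apply: Rintegral_ge0 => x _; rewrite -expr2 sqr_ge0. Qed.

Lemma L2_norm_sqr f : L2_norm f ^+ 2 = L2_inner f f.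
Proof. by rewrite sqr_sqrtr// L2_inner_ge0. Qed.

(** The residual f - <f, e> e has a nonnegative square. *)
Lemma L2_bessel f e : L2_inner e e = 1 -> L2_inner f e ^+ 2 <= L2_norm f ^+ 2.
Proof.
move=> e1; have := L2_inner_ge0 (f - L2_inner f e *: e).
rewrite L2_innerBl L2_innerZl ![L2_inner _ (_ - _)]L2_innerC.
rewrite !L2_innerBl !L2_innerZl e1 [L2_inner e f]L2_innerC mulr1 subrr mulr0 subr0.
by rewrite subr_ge0 L2_norm_sqr expr2.
Qed.

(* A generated sigma-algebra makes a measurable type of a pointed type. *)
HB.instance Definition _ := isPointed.Build (L2 mu) 0.

(** A coordinate along a unit vector is a contraction for the L^2 norm, so
    that the preimages of open rays are open. *)
Lemma L2_borel_coord e (B : set R) : L2_inner e e = 1 -> measurable B ->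
  L2_borel ((fun f => L2_inner f e) @^-1` B).
Proof.
move=> e1 mB.
have : measurable_fun [set: g_sigma_algebraType (@L2_open _ _ _ mu)]
    (fun f : L2 mu => L2_inner f e).
  apply: (measurability _ (RGenOInfty.measurableE R)).
  move=> _ [_ [x ->] <-]; rewrite setTI; apply: sub_sigma_algebra => f /=.
  rewrite in_itv/= andbT => xf.
  exists (L2_inner f e - x); first by rewrite subr_gt0.
  move=> g gf; rewrite in_itv/= andbT; apply: contraTT (gf); rewrite -!leNgt => gx.
  rewrite (@le_trans _ _ `|L2_inner (g - f) e|)//.
    by rewrite L2_innerBl distrC (le_trans _ (ler_norm _))// lerB.
  rewrite -(ler_pXn2r (ltn0Sn 1)) ?nnegrE ?sqrtr_ge0// real_normK ?num_real//.
  exact: L2_bessel.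
by move=> /(_ measurableT _ mB); rewrite setTI.
Qed.
End L2_inner_product.

(** * Orthonormality of the spherical harmonics *)

Section spherical_harmonics.
Variable R : realType.
Local Notation leb := (@lebesgue_measure R).
Local Notation surf := (@surface R).

(** In the coordinates height and longitude the surface measure is the
    Lebesgue measure of a rectangle, over which Fubini's theorem applies. *)
Lemma surface_Rintegral (h : sphere R -> R) (a b : R -> R) :
  surf.-integrable setT (EFin \o h) -> continuous a -> continuous b ->
  (forall p, cyl_domain p -> h (cylindrical p) = a p.1 * b p.2) ->
  \int[surf]_x h x =
  (\int[leb]_(z in `[-1, 1]) a z) * \int[leb]_(t in `[0, pi *+ 2]) b t.
Proof.
move=> hi ca cb hE.
have mh := measurable_int _ hi.
have mcyl := @measurable_cylindrical R.
have ci : (mrestr (leb \x leb)%E (@measurable_cyl_domain R)).-integrable setT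
    ((EFin \o h) \o @cylindrical R).
  apply/integrableP; split; first exact: measurableT_comp.
  have /integrableP[_] := hi; apply: le_lt_trans.
  rewrite le_eqVlt; apply/orP; left; apply/eqP; apply/esym.
  rewrite (ge0_integral_pushforward mcyl)//.
  exact: measurableT_comp.
rewrite [LHS]/Rintegral (integral_pushforward mcyl mh ci)// preimage_setT.
rewrite integral_mrestr// integral_mkcond.
transitivity (fine (\int[leb \x leb]_p
    ((a \_ `[-1, 1]) p.1 * (b \_ `[0, pi *+ 2]) p.2)%:E)%E).
  congr fine; apply: eq_integral => p _; rewrite /patch /=.
  have [pD|pD] := boolP (p \in @cyl_domain R).
    have [p1 p2] := set_mem pD.
    by rewrite hE ?(mem_set p1) ?(mem_set p2)//; exact: set_mem.
  have [p1|] := boolP (p.1 \in `[-1, 1]%classic); last by rewrite mul0r.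
  have [p2|] := boolP (p.2 \in `[0, pi *+ 2]%classic); last by rewrite mulr0.
  by rewrite notin_setE in pD; case: pD; split => /=; apply: set_mem.
have fin (f : R -> R) (u v : R) : continuous f ->
    leb.-integrable setT (EFin \o (f \_ `[u, v])).
  move=> cf; rewrite -restrict_EFin; apply: (integrable_mkcond _ _).1 => //.
  exact: continuous_itv_integrable.
rewrite integral_tensor; [|exact: fin..].
rewrite fineM; [|exact/integrable_fin_num/fin..].
by rewrite [X in _ = X * _]Rintegral_mkcond [X in _ = _ * X]Rintegral_mkcond.
Qed.

Lemma on_sphere_cylindrical (z t : R) : z ^+ 2 <= 1 ->
  on_sphere (Num.sqrt (1 - z ^+ 2) * cos t, Num.sqrt (1 - z ^+ 2) * sin t, z).
Proof.
move=> z1; rewrite /on_sphere /= !exprMn -mulrDr cos2Dsin2 mulr1.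
by rewrite sqr_sqrtr ?subr_ge0// subrK.
Qed.

Lemma de_moivre (r t : R) k : complex.Complex (r * cos t) (r * sin t) ^+ k =
  complex.Complex (r ^+ k * cos (k%:R * t)) (r ^+ k * sin (k%:R * t)).
Proof.
elim: k => [|k IHk]; first by rewrite !expr0 !mul0r cos0 sin0 mulr1 mulr0.
rewrite exprS IHk; congr complex.Complex; rewrite -natr1 mulrDl mul1r exprS.
  by rewrite cosD /=; ring.
by rewrite sinD /=; ring.
Qed.

(** The L^2 normalisation of the harmonics of degree l and orders k and - k. *)
Definition harm_norm (l k : nat) : R :=
  Num.sqrt ((l.*2.+1)%:R / (4 * pi) * ((l - k)`!%:R / (l + k)`!%:R)).

(** At height z and longitude t, x + i y = sqrt (1 - z^2) e^(i t), whose
    powers are given by de Moivre's formula. *)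
Lemma real_sph_harm_cylindrical l m (p : R * R) : cyl_domain p ->
  real_sph_harm l m (cylindrical p) =
  harm_norm l `|m| * ((legendre R l)^`(`|m|%N)).[p.1] *
    Num.sqrt (1 - p.1 ^+ 2) ^+ `|m| * azimuth m p.2.
Proof.
move=> [/= p1 _]; have {}p1 : p.1 ^+ 2 <= 1.
  by move: p1; rewrite in_itv/= => /andP[? ?]; nra.
rewrite /real_sph_harm /cylindrical insubdK; last exact: on_sphere_cylindrical.
rewrite de_moivre /= -/(harm_norm l `|m|) -[RHS]mulrA; congr (_ * _).
rewrite /azimuth; case: (m =P 0) => [->|_]; first by rewrite absz0 expr0 mul1r.
rewrite mulrCA; case: ifP => _; first by rewrite subr0.
by rewrite cosBpihalf.
Qed.

(** Different orders are separated by the longitude, and different degrees of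
    the same order by the height. *)
Lemma sphY_orthonormal l m l' m' : (`|m| <= l)%N -> (`|m'| <= l')%N ->
  L2_inner (sphY l m : L2 surf) (sphY l' m') = ((l == l') && (m == m'))%:R.
Proof.
move=> ml ml'; rewrite /sphY L2_inner_pi.
pose a (z : R) := harm_norm l `|m| * harm_norm l' `|m'| *
  ((legendre R l)^`(`|m|%N) * (legendre R l')^`(`|m'|%N)).[z] *
  (Num.sqrt (1 - z ^+ 2) ^+ `|m| * Num.sqrt (1 - z ^+ 2) ^+ `|m'|).
have cs n : continuous (fun z : R => Num.sqrt (1 - z ^+ 2) ^+ n).
  move=> x; apply: (@continuous_comp _ _ _ (fun z : R => Num.sqrt (1 - z ^+ 2))
    (fun y => y ^+ n)).
    apply: (@continuous_comp _ _ _ (fun z : R => 1 - z ^+ 2) Num.sqrt).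
      by apply: cvgB; [exact: cvg_cst|exact: exprn_continuous].
    exact: sqrt_continuous.
  exact: exprn_continuous.
have eval_weighted c (p : {poly R}) n z :
    (c *: (p * (1 - 'X^2) ^+ n)).[z] = c * p.[z] * (1 - z ^+ 2) ^+ n.
  by rewrite hornerZ hornerM horner_exp !hornerE.
(* The factor a collects everything that depends on the height. *)
rewrite (@surface_Rintegral _ a (fun t => azimuth m t * azimuth m' t)).
- rewrite azimuth_inner; have [mm|_] := eqVneq m m'; last by rewrite andbF mulr0.
  rewrite andbT /a -mm; move: ml'; rewrite -mm => ml'; set k := `|m|%N in ml ml' *.
  transitivity (poly_integral ((harm_norm l k * harm_norm l' k) *:
      ((legendre R l)^`(k) * (legendre R l')^`(k) * (1 - 'X^2) ^+ k)) * (pi *+ 2)).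
    congr (_ * _); apply: eq_Rintegral => z.
    rewrite inE/= in_itv/= => /andP[z1 z2].
    have z0 : 0 <= 1 - z ^+ 2 by nra.
    by rewrite eval_weighted -exprMn -expr2 sqr_sqrtr.
  rewrite linearZ/= legendre_inner//; have [<-|] := eqVneq l l'; last first.
    by rewrite mulr0 mul0r.
  have f0 n : n`!%:R != 0 :> R by rewrite pnatr_eq0 -lt0n fact_gt0.
  have l0 : l.*2.+1%:R != 0 :> R by rewrite pnatr_eq0.
  have alg (A B C D : R) : A != 0 -> B != 0 -> C != 0 -> D != 0 ->
    A / (4 * B) * (C / D) * (2 / A * (D / C)) * (B *+ 2) = 1.
    by move=> *; field; exact/and4P.
  rewrite -expr2 sqr_sqrtr ?alg// ?gt_eqF ?pi_gt0//.
  by rewrite mulr_ge0// divr_ge0// mulr_ge0// pi_ge0.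
- exact: L2fun_mul_integrable.
- move=> z; apply: cvgM; last by apply: cvgM; exact: cs.
  by apply: cvgM; [exact: cvg_cst|exact: continuous_horner].
- by move=> t; apply: cvgM; exact: continuous_azimuth.
- move=> p pD; rewrite -[LHS]/(real_sph_harm l m (cylindrical p) *
    real_sph_harm l' m' (cylindrical p)).
  rewrite !real_sph_harm_cylindrical// /a hornerM; ring.
Qed.
End spherical_harmonics.

(** * Spectral coordinates of the integrator *)

Section spectral_truncation.
Variable R : realType.
Local Notation L2S2 := (L2 (@surface R)).
Local Notation eigenvalue := Defs.eigenvalue.
Implicit Types (kappa l : nat) (g h : R -> R) (u v : L2S2).

Lemma sphYi_orthonormal l (i : 'I_l.*2.+1) l' (j : 'I_l'.*2.+1) :
  L2_inner (sphYi R i) (sphYi R j) = ((l == l') && (i == j :> nat))%:R.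
Proof.
rewrite sphY_orthonormal; [|by have := ltn_ord i; lia|by have := ltn_ord j; lia].
congr (nat_of_bool _)%:R.
by apply/andP/andP => -[/eqP ll' /eqP ij]; split; apply/eqP; lia.
Qed.

Lemma calculus_coord kappa g u l (i : 'I_l.*2.+1) :
  L2_inner (calculus kappa g u) (sphYi R i) =
  if (l <= kappa)%N then g (eigenvalue R l) * L2_inner u (sphYi R i) else 0.
Proof.
have inner_l l' : L2_inner (\sum_(j < l'.*2.+1)
      (g (eigenvalue R l') * L2_inner u (sphYi R j)) *: sphYi R j) (sphYi R i) =
    if l' == l then g (eigenvalue R l) * L2_inner u (sphYi R i) else 0.
  rewrite L2_inner_suml; under eq_bigr do rewrite L2_innerZl sphYi_orthonormal.
  have [ll'|ll'] := eqVneq l' l; last by rewrite big1// => j _; rewrite mulr0.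
  move: i; rewrite -ll' => i.
  rewrite (bigD1 i)//= eqxx mulr1 big1 ?addr0// => j ji.
  by rewrite (negbTE ji : (j == i :> nat) = false) mulr0.
rewrite /calculus L2_inner_suml; under eq_bigr do rewrite inner_l.
case: leqP => lk.
  rewrite (bigD1 (inord l))//= inordK// eqxx big1 ?addr0// => l'.
  by rewrite -val_eqE /= inordK// => /negbTE ->.
by rewrite big1// => l' _; rewrite ifN// neq_ltn (leq_ltn_trans _ lk) ?orbT// -ltnS.
Qed.

Lemma calculus_norm kappa g u : L2_norm (calculus kappa g u) ^+ 2 =
  \sum_(l < kappa.+1) \sum_(i < l.*2.+1)
    (g (eigenvalue R l) * L2_inner u (sphYi R i)) ^+ 2.
Proof.
rewrite L2_norm_sqr {1}/calculus L2_inner_suml; apply: eq_bigr => l _.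
rewrite L2_inner_suml; apply: eq_bigr => i _.
rewrite L2_innerZl [L2_inner (sphYi R i) _]L2_innerC calculus_coord.
by rewrite -ltnS ltn_ord.
Qed.

Lemma projH_calculus kappa g u :
  projH kappa (calculus kappa g u) = calculus kappa g u.
Proof.
apply: eq_bigr => l _; apply: eq_bigr => i _.
by rewrite calculus_coord -ltnS ltn_ord mul1r.
Qed.

Lemma projHD kappa u v : projH kappa (u + v) = projH kappa u + projH kappa v.
Proof.
rewrite /projH /calculus -big_split; apply: eq_bigr => l _ /=.
rewrite -big_split; apply: eq_bigr => i _ /=.
by rewrite L2_innerDl mulrDr scalerDl.
Qed.

Lemma projHN kappa u : projH kappa (- u) = - projH kappa u.
Proof.
apply/eqP; rewrite -addr_eq0 -projHD addNr; apply/eqP.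
rewrite /projH /calculus big1// => l _; rewrite big1// => i _.
have -> : L2_inner 0 (sphYi R i) = 0 by rewrite -(scale0r u) L2_innerZl mul0r.
by rewrite mulr0 scale0r.
Qed.

(** The square root of the eigenvalue makes the energy of a mode half of the
    sum of the squares of its amplitude and velocity. *)
Definition wave_amplitude l (i : 'I_l.*2.+1) (u : L2S2 * L2S2) : R :=
  Num.sqrt (eigenvalue R l) * L2_inner u.1 (sphYi R i).

Definition wave_velocity l (i : 'I_l.*2.+1) (u : L2S2 * L2S2) : R :=
  L2_inner u.2 (sphYi R i).

(** The value prescribed at the eigenvalue 0 is multiplied by 0, so that the
    amplitude of every mode, even of the constant one, follows the rotation. *)
Lemma sqrt_sinc (tau x : R) : 0 <= x ->
  Num.sqrt x * (if x == 0 then tau else (Num.sqrt x)^-1 * sin (tau * Num.sqrt x)) =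
  sin (tau * Num.sqrt x).
Proof.
rewrite le_eqVlt => /orP[/eqP<-|x0].
  by rewrite sqrtr0 mul0r mulr0 sin0.
by rewrite gt_eqF// mulrA divff ?mul1r// gt_eqF// sqrtr_gt0.
Qed.

Lemma trig_step_amplitude kappa (tau : R) l (i : 'I_l.*2.+1)
  (u : L2S2 * L2S2) (dL : L2S2) : (l <= kappa)%N ->
  wave_amplitude i (trig_step kappa tau u dL) =
  cos (tau * Num.sqrt (eigenvalue R l)) * wave_amplitude i u +
  sin (tau * Num.sqrt (eigenvalue R l)) *
    (wave_velocity i u + L2_inner dL (sphYi R i)).
Proof.
move=> lk; have sinc := sqrt_sinc tau (ler0n R (l * l.+1)).
rewrite -/(eigenvalue R l) in sinc.
rewrite /wave_amplitude /wave_velocity /= !L2_innerDl.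
rewrite /cosL /sincL /projH !calculus_coord lk mul1r.
move: sinc; set q := (if _ then _ else _) => <-.
move: q (Num.sqrt _) (cos _) => q' x c; ring.
Qed.

Lemma trig_step_velocity kappa (tau : R) l (i : 'I_l.*2.+1)
  (u : L2S2 * L2S2) (dL : L2S2) : (l <= kappa)%N ->
  wave_velocity i (trig_step kappa tau u dL) =
  - sin (tau * Num.sqrt (eigenvalue R l)) * wave_amplitude i u +
  cos (tau * Num.sqrt (eigenvalue R l)) *
    (wave_velocity i u + L2_inner dL (sphYi R i)).
Proof.
move=> lk; rewrite /wave_amplitude /wave_velocity /= !L2_innerDl L2_innerNl.
rewrite /cosL /LsinL /projH !calculus_coord lk mul1r.
move: (Num.sqrt _) (sin _) (cos _) => x s c; ring.
Qed.

(** A step adds the increment to the velocity, and then rotates the pair made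
    of the amplitude and the velocity. *)
Lemma trig_step_mode_energy kappa (tau : R) l (i : 'I_l.*2.+1)
  (u : L2S2 * L2S2) (dL : L2S2) : (l <= kappa)%N ->
  wave_velocity i (trig_step kappa tau u dL) ^+ 2 +
    wave_amplitude i (trig_step kappa tau u dL) ^+ 2 =
  wave_velocity i u ^+ 2 + wave_amplitude i u ^+ 2 +
    2 * (wave_velocity i u * L2_inner dL (sphYi R i)) +
    L2_inner dL (sphYi R i) ^+ 2.
Proof.
move=> lk; rewrite trig_step_amplitude// trig_step_velocity//.
set x := tau * _; move: (wave_velocity i u) (wave_amplitude i u) (L2_inner dL _).
move=> b a z.
(* The squared length of a vector before its rotation by x. *)
transitivity ((cos x ^+ 2 + sin x ^+ 2) * (a ^+ 2 + (b + z) ^+ 2)).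
  ring.
rewrite cos2Dsin2; ring.
Qed.

(** Parseval's identity in H^kappa, where the velocity is assumed to lie. *)
Lemma discrete_energyE kappa (u : L2S2 * L2S2) : projH kappa u.2 = u.2 ->
  discrete_energy kappa u = 2^-1 * \sum_(l < kappa.+1) \sum_(i < l.*2.+1)
    (wave_velocity i u ^+ 2 + wave_amplitude i u ^+ 2).
Proof.
move=> u2; rewrite /discrete_energy -[X in L2_norm X ^+ 2 + _]u2.
rewrite [X in X + _]calculus_norm [X in _ + X]calculus_norm -big_split.
congr (_ * _); apply: eq_bigr => l _ /=; rewrite -big_split.
by apply: eq_bigr => i _ /=; rewrite mul1r.
Qed.

Lemma trig_integrator_projH {Omega : Type} kappa tau (v1 v2 : Omega -> L2S2)
    (L : R -> Omega -> L2S2) n w :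
  projH kappa (trig_integrator kappa tau v1 v2 L n w).2 =
  (trig_integrator kappa tau v1 v2 L n w).2.
Proof.
case: n => [|n] /=; first exact: projH_calculus.
by rewrite !projHD projHN !projH_calculus.
Qed.

(** The diagonal entries of Q^kappa are those of Q up to degree kappa and zero
    beyond, so that the series is a finite sum. *)
Lemma truncation_trace kappa (Q : L2S2 -> L2S2) :
  L2_trace (truncation kappa Q) =
  (\sum_(l < kappa.+1) \sum_(i < l.*2.+1) L2_inner (Q (sphYi R i)) (sphYi R i))%:E.
Proof.
have inner_l l (i : 'I_l.*2.+1) l' :
    \sum_(j < l'.*2.+1) (1 * L2_inner (sphYi R i) (sphYi R j)) *: sphYi R j =
    if l' == l then sphYi R i else 0.
  under eq_bigr do rewrite sphYi_orthonormal mul1r.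
  have [ll'|ll'] := eqVneq l' l; last first.
    by rewrite big1// => j _; rewrite scale0r.
  move: i; rewrite -ll' => i.
  rewrite (bigD1 i)//= !eqxx scale1r big1 ?addr0// => j ji.
  by rewrite eq_sym in ji; rewrite (negbTE ji : (i == j :> nat) = false) scale0r.
have projY l (i : 'I_l.*2.+1) : (l <= kappa)%N ->
    projH kappa (sphYi R i) = sphYi R i.
  move=> lk; rewrite /projH /calculus; under eq_bigr do rewrite inner_l.
  rewrite (bigD1 (inord l))//= inordK// eqxx big1 ?addr0// => l'.
  by rewrite -val_eqE /= inordK// => /negbTE ->.
pose F l : \bar R := (\sum_(i < l.*2.+1)
  (L2_inner (truncation kappa Q (sphYi R i)) (sphYi R i))%:E)%E.
rewrite /L2_trace -/F.
apply: cvg_lim => //; apply: cvg_near_cst; exists kappa.+1 => // n /= kn.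
rewrite (big_cat_nat (n := kappa.+1))//=.
rewrite [X in (_ + X)%E]big1_seq ?adde0; last first.
  move=> l /=; rewrite mem_index_iota => /andP[kl _].
  rewrite big1// => i _; rewrite /truncation {1}/projH calculus_coord.
  by rewrite leqNgt kl.
rewrite big_mkord -sumEFin; apply: eq_bigr => l _.
rewrite -sumEFin; apply: eq_bigr => i _.
have lk : (l <= kappa)%N by rewrite -ltnS.
by rewrite /truncation projY// {1}/projH calculus_coord lk mul1r.
Qed.
End spectral_truncation.

(** * Independence and expectations *)

Section independence.
Context d (Omega : measurableType d) (R : realType) (P : probability Omega R).
Local Open Scope ereal_scope.

(** Independence identifies the joint law with the product of the two laws,
    and Fubini's theorem factors the integral of the product of the
    coordinates. *)
Lemma expectationM_indep (X Y : {RV P >-> R}) :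
  (forall A B, measurable A -> measurable B ->
    P (X @^-1` A `&` Y @^-1` B) = P (X @^-1` A) * P (Y @^-1` B)) ->
  P.-integrable setT (EFin \o X) -> P.-integrable setT (EFin \o Y) ->
  'E_P[fun w => (X w * Y w)%R] = 'E_P[X] * 'E_P[Y].
Proof.
move=> XY Xi Yi.
pose Zmix := isMeasurableFun.Build _ _ _ _ (fun w => (X w, Y w))
  (measurable_fun_pair (measurable_funPT X) (measurable_funPT Y)).
pose Z : {mfun Omega >-> (R * R)%type} :=
  HB.pack (fun w => (X w, Y w)) Zmix.
have law A : measurable A ->
    (distribution P X \x distribution P Y) A = distribution P Z A.
  by apply: product_measure_unique => B C mB mC; rewrite -XY.
have lawi (V : {RV P >-> R}) : P.-integrable setT (EFin \o V) ->
    (distribution P V).-integrable setT (EFin \o @id R).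
  move=> /integrableP[_ Vi]; apply/integrableP; split; first exact: EFin_measurable.
  rewrite ge0_integral_distribution//.
  by apply: measurableT_comp => //; exact: EFin_measurable.
have := integral_tensor (lawi X Xi) (lawi Y Yi).
have := integrable_tensor (lawi X Xi) (lawi Y Yi).
move=> /integrableP[mZ Zi].
rewrite (eq_measure_integral (distribution P Z)); last first.
  by move=> A mA _; exact: law.
rewrite !integral_distribution//.
- by rewrite unlock.
- apply/integrableP; split; first exact: measurableT_comp.
  apply: le_lt_trans Zi.
  rewrite (eq_measure_integral (distribution P Z)); last first.
    by move=> A mA _; exact: law.
  rewrite ge0_integral_distribution//.
  exact: measurableT_comp.
Qed.
End independence.

Section sub_sigma_algebra.
Context d (Omega : measurableType d) (R : realType) (P : probability Omega R).
Implicit Types (G H : set_system Omega) (X Y : Omega -> R).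

(** Measurability for a sub-sigma-algebra G is expressed through the
    measurable type that G generates, for which the general closure properties
    of measurable functions hold. *)
Definition sigma_measurable G X :=
  measurable_fun [set: g_sigma_algebraType G] X.

Lemma sigma_measurableW G H X : G `<=` H ->
  sigma_measurable G X -> sigma_measurable H X.
Proof.
move=> GH mX _ B mB; have := mX measurableT _ mB.
by apply: smallest_sub; [exact: smallest_sigma_algebra|
  exact: subset_trans (@sub_sigma_algebra _ _ _)].
Qed.

Lemma sigma_measurable_measurable G X : G `<=` measurable ->
  sigma_measurable G X -> measurable_fun setT X.
Proof.
move=> GH mX _ B mB; have := mX measurableT _ mB.
by apply: smallest_sub => //; exact: sigma_algebra_measurable.
Qed.

Lemma sigma_measurable_preimage G X B : sigma_algebra setT G ->
  sigma_measurable G X -> measurable B -> G (X @^-1` B).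
Proof.
move=> sG mX mB; have := mX measurableT _ mB.
by rewrite setTI /measurable/= sigma_algebra_id.
Qed.

Lemma sigma_measurable_coord d' (T : measurableType d')
    (mu : {measure set T -> \bar R}) G (V : Omega -> L2 mu) e :
  L2_inner e e = 1 -> L2_measurable G V ->
  sigma_measurable G (fun w => L2_inner (V w) e).
Proof.
move=> e1 mV _ B mB; rewrite setTI; apply: sub_sigma_algebra.
exact: (mV _ (L2_borel_coord e1 mB)).
Qed.

Lemma sq_integrable_Lfun X : measurable_fun setT X ->
  (\int[P]_w (X w ^+ 2)%:E < +oo)%E -> X \in Lfun P 2%:E.
Proof.
move=> mX X2; rewrite inE; apply/andP; split; rewrite inE//=.
rewrite /finite_norm unlock poweR_lty//.
rewrite (eq_integral (fun w => (X w ^+ 2)%:E))// => w _.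
by rewrite /= powR_mulrn// real_normK ?num_real.
Qed.

Lemma Lfun2_Lfun1 X : X \in Lfun P 2%:E -> X \in Lfun P 1.
Proof. by apply: Lfun_subset12; exact: fin_num_measure. Qed.

Lemma Lfun2M X Y : X \in Lfun P 2%:E -> Y \in Lfun P 2%:E ->
  (fun w => X w * Y w) \in Lfun P 1.
Proof. exact: Lfun2_mul_Lfun1. Qed.

Lemma Lfun2Z (a : R) X : X \in Lfun P 2%:E -> (fun w => a * X w) \in Lfun P 2%:E.
Proof.
move=> X2; have -> : (fun w => a * X w) = a \o* X.
  by apply/funext => w /=; rewrite mulrC.
by apply: Lfun_scale => //; rewrite ler1n.
Qed.

Lemma expectation_bigsum (I : Type) (r : seq I) (X : I -> Omega -> R) :
  (forall i, X i \in Lfun P 1) ->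
  (fun w => \sum_(i <- r) X i w) \in Lfun P 1 /\
  'E_P[fun w => (\sum_(i <- r) X i w)%R]%E = (\sum_(i <- r) 'E_P[X i])%E.
Proof.
move=> X1; elim: r => [|i r [IH1 IH2]].
  have -> : (fun w => \sum_(i <- [::]) X i w) = cst 0.
    by apply/funext => w; rewrite big_nil.
  by rewrite expectation_cst big_nil Lfun_cst.
have -> : (fun w => \sum_(j <- i :: r) X j w) =
    X i \+ (fun w => \sum_(j <- r) X j w).
  by apply/funext => w; rewrite big_cons.
by rewrite expectationD// IH2 big_cons rpredD.
Qed.
End sub_sigma_algebra.

(** * Coordinates of the driving process *)

Section levy_coordinate.
Context dO (Omega : measurableType dO) (R : realType) (P : probability Omega R).
Context d (T : measurableType d) (mu : {measure set T -> \bar R}).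
Context (F : R -> set_system Omega) (L : R -> Omega -> L2 mu) (Q : L2 mu -> L2 mu).
Context (e : L2 mu) (e1 : L2_inner e e = 1).
Hypotheses (HF : complete_filtration P F) (HL : sq_integrable_levy P F L).
Hypotheses (HL_mean : mean_zero P L) (HQ : covariance_operator P L Q).

Local Notation coord t := (fun w => L2_inner (L t w) e).
Local Notation dcoord s t := (fun w => L2_inner (L t w - L s w) e).

Lemma levy_coord_adapted t : 0 <= t -> sigma_measurable (F t) (coord t).
Proof.
by move=> t0; apply: sigma_measurable_coord => //; exact: levy_adapted HL t t0.
Qed.

Lemma levy_coord_Lfun t : 0 <= t -> coord t \in Lfun P 2%:E.
Proof.
move=> t0; apply: sq_integrable_Lfun.
  exact: sigma_measurable_measurable (filtration_sub HF t0) (levy_coord_adapted t0).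
have := HQ e e t0; rewrite unlock => h.
by under eq_integral do rewrite expr2; rewrite h ltry.
Qed.

Lemma levy_increment_Lfun s t : 0 <= s -> s <= t -> dcoord s t \in Lfun P 2%:E.
Proof.
move=> s0 st.
have -> : dcoord s t = coord t - coord s.
  by apply/funext => w; rewrite L2_innerBl.
apply: rpredB => [|p1|p1]; first by rewrite lee1n.
  by apply: levy_coord_Lfun; exact: le_trans st.
exact: levy_coord_Lfun.
Qed.

(** The increment is centred and independent of the past, to which X belongs. *)
Lemma levy_increment_orthogonal s t (X : Omega -> R) : 0 <= s -> s <= t ->
  sigma_measurable (F s) X -> X \in Lfun P 2%:E ->
  'E_P[fun w => (X w * L2_inner (L t w - L s w) e)%R]%E = 0%E.
Proof.
move=> s0 st mX X2; have t0 := le_trans s0 st.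
have Y2 := levy_increment_Lfun s0 st.
have mXO := sigma_measurable_measurable (filtration_sub HF s0) mX.
have mY : measurable_fun setT (dcoord s t).
  by move: Y2; rewrite inE => /andP[/[!inE]].
pose Xm : {mfun Omega >-> R} := HB.pack X (isMeasurableFun.Build _ _ _ _ X mXO).
pose Ym : {mfun Omega >-> R} :=
  HB.pack (dcoord s t) (isMeasurableFun.Build _ _ _ _ (dcoord s t) mY).
rewrite (@expectationM_indep _ _ _ P Xm Ym).
- have -> : ('E_P[Ym] = 0)%E.
    have -> : (Ym : Omega -> R) = coord t \- coord s.
      by apply/funext => w /=; rewrite L2_innerBl.
    by rewrite expectationB ?HL_mean ?sube0//;
      apply: Lfun2_Lfun1; exact: levy_coord_Lfun.
  by rewrite mule0.
- move=> A B mA mB.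
  have FA := sigma_measurable_preimage (filtration_sigma HF s0) mX mA.
  exact: (levy_indep HL s0 st (L2_borel_coord e1 mB) FA).
- exact/Lfun1_integrable/Lfun2_Lfun1.
- exact/Lfun1_integrable/Lfun2_Lfun1.
Qed.

(** Expand the square of L t as that of L s plus the increment: the cross term
    vanishes, and the covariance operator gives the second moments at the
    times s and t. *)
Lemma levy_increment_variance s t : 0 <= s -> s <= t ->
  'E_P[fun w => (L2_inner (L t w - L s w) e ^+ 2)%R]%E =
  ((t - s) * L2_inner (Q e) e)%:E.
Proof.
move=> s0 st; have t0 := le_trans s0 st.
have Y2 := levy_increment_Lfun s0 st; have X2 := levy_coord_Lfun s0.
have XX := HQ e e s0; have := HQ e e t0.
have -> : (fun w => (L2_inner (L t w) e * L2_inner (L t w) e)%R) =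
   ((fun w => (L2_inner (L s w) e * L2_inner (L s w) e)%R) \+
    (fun w => (2 * L2_inner (L s w) e) * L2_inner (L t w - L s w) e)) \+
    (fun w => L2_inner (L t w - L s w) e ^+ 2).
  by apply/funext => w /=; rewrite L2_innerBl; ring.
have Z :
    ('E_P[fun w => ((2 * L2_inner (L s w) e) * L2_inner (L t w - L s w) e)%R] = 0)%E.
  apply: levy_increment_orthogonal => //; last exact: Lfun2Z.
  by apply: measurable_funM => //; exact: levy_coord_adapted.
have I1 := Lfun2M X2 X2; have I2 := Lfun2M (Lfun2Z 2 X2) Y2.
have I3 := Lfun2M Y2 Y2.
rewrite expectationD//; last by apply: rpredD; [exact: I1|exact: I2].
rewrite expectationD// XX Z adde0 => E.
have : ('E_P[fun w => (L2_inner (L t w - L s w) e ^+ 2)%R] \is a fin_num)%E.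
  exact: expectation_fin_num.
move: E; case: ('E_P[_])%E => // r [E] _; congr EFin.
by rewrite mulrBl -E addrAC subrr add0r.
Qed.
End levy_coordinate.

(** * Expected energy of one mode *)

Section mode_dynamics.
Context (R : realType) (dO : measure_display) (Omega : measurableType dO)
  (P : probability Omega R) (F : R -> set_system Omega).
Local Notation L2S2 := (L2 (@surface R)).
Local Notation eigenvalue := Defs.eigenvalue.
Context (v1 v2 : Omega -> L2S2) (L : R -> Omega -> L2S2) (Q : L2S2 -> L2S2).
Context (kappa : nat) (tau : R) (tau0 : 0 < tau).
Hypotheses (HF : complete_filtration P F) (HL : sq_integrable_levy P F L).
Hypotheses (HL_mean : mean_zero P L) (HQ : covariance_operator P L Q).
Hypotheses (Hv1 : L2_measurable (F 0) v1) (Hv2 : L2_measurable (F 0) v2).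
Hypothesis Henergy : (\int[P]_w initial_energy (v1 w) (v2 w) < +oo)%E.
Context (l : nat) (i : 'I_l.*2.+1) (lk : (l <= kappa)%N).

Local Notation u := (trig_integrator kappa tau v1 v2 L).
Local Notation vel n := (fun w => wave_velocity i (u n w)).
Local Notation amp n := (fun w => wave_amplitude i (u n w)).
Local Notation time n := (n%:R * tau).

Let Y1 : L2_inner (sphYi R i) (sphYi R i) = 1.
Proof. by rewrite sphYi_orthonormal !eqxx. Qed.

(** With the next bound, this gives every mode a finite second moment at time
    0. *)
Lemma initial_energy_velocity (f g : L2S2) :
  ((2^-1 * L2_inner g (sphYi R i) ^+ 2)%:E <= initial_energy f g)%E.
Proof.
rewrite /initial_energy EFinM lee_wpmul2l ?lee_fin//.
rewrite (@le_trans _ _ (L2_norm g ^+ 2)%:E) ?lee_fin ?L2_bessel//.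
by rewrite leeDl// nneseries_ge0// => n _ _; apply: sume_ge0 => j _;
  rewrite lee_fin sqr_ge0.
Qed.

Lemma initial_energy_amplitude (f g : L2S2) :
  ((2^-1 * (Num.sqrt (eigenvalue R l) * L2_inner f (sphYi R i)) ^+ 2)%:E
    <= initial_energy f g)%E.
Proof.
rewrite /initial_energy EFinM lee_wpmul2l ?lee_fin//.
pose t k : \bar R := (\sum_(j < k.*2.+1)
  ((Num.sqrt (eigenvalue R k) * L2_inner f (sphYi R j)) ^+ 2)%:E)%E.
have t0 k : (0 <= t k)%E by apply: sume_ge0 => j _; rewrite lee_fin sqr_ge0.
rewrite (@le_trans _ _ (t l))//.
  rewrite /t (bigD1 i)//= leeDl// sume_ge0// => j _; rewrite lee_fin sqr_ge0//.
rewrite (@le_trans _ _ (calculus_norm2 Num.sqrt f))//; last first.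
  by rewrite leeDr// lee_fin sqr_ge0.
apply: (@le_trans _ _ (\sum_(0 <= k < l.+1) t k)%E).
  by rewrite big_nat_recr//= leeDr// sume_ge0.
by apply: nneseries_lim_ge => k _ _; exact: t0.
Qed.

Lemma initial_mode_Lfun (X : Omega -> R) : sigma_measurable (F 0) X ->
  (forall w, ((2^-1 * X w ^+ 2)%:E <= initial_energy (v1 w) (v2 w))%E) ->
  X \in Lfun P 2%:E.
Proof.
move=> mX XE.
have mXO := sigma_measurable_measurable (filtration_sub HF (lexx 0)) mX.
apply: sq_integrable_Lfun => //.
have : (\int[P]_w (2^-1 * X w ^+ 2)%:E < +oo)%E.
  apply: le_lt_trans Henergy; apply: integral_mono => // w.
  by rewrite lee_fin mulr_ge0// sqr_ge0.
under eq_integral do rewrite EFinM.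
rewrite ge0_integralZl//.
- move=> h; rewrite ltNge leye_eq; apply/negP => /eqP e; move: h.
  by rewrite e mulry gtr0_sg ?mul1e ?ltxx// invr_gt0.
- by apply/measurable_EFinP; exact: measurable_funX.
- by move=> w _; rewrite lee_fin sqr_ge0.
Qed.

Let timeS n : time n <= time n.+1.
Proof. by rewrite ler_pM2r// ler_nat. Qed.

Let time0 n : 0 <= time n.
Proof. by rewrite mulr_ge0// ltW. Qed.

(** A step makes the new amplitude and velocity linear combinations of the old
    ones and of an increment known at the end of the step. *)
Lemma mode_adapted n :
  [/\ sigma_measurable (F (time n)) (vel n), sigma_measurable (F (time n)) (amp n),
      vel n \in Lfun P 2%:E & amp n \in Lfun P 2%:E].
Proof.
elim: n => [|n [mv ma v2n a2n]].
  have v0E w : wave_velocity i (u 0 w) = L2_inner (v2 w) (sphYi R i).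
    by rewrite /wave_velocity /= /projH calculus_coord lk mul1r.
  have a0E w : wave_amplitude i (u 0 w) =
      Num.sqrt (eigenvalue R l) * L2_inner (v1 w) (sphYi R i).
    by rewrite /wave_amplitude /= /projH calculus_coord lk mul1r.
  have mv : sigma_measurable (F 0) (vel 0).
    by rewrite (funext v0E); exact: sigma_measurable_coord.
  have ma : sigma_measurable (F 0) (amp 0).
    rewrite (funext a0E); apply: measurable_funM => //.
    exact: sigma_measurable_coord.
  rewrite mul0r; split=> //.
  - apply: initial_mode_Lfun => // w; rewrite v0E; exact: initial_energy_velocity.
  - apply: initial_mode_Lfun => // w; rewrite a0E; exact: initial_energy_amplitude.
pose dW w := L2_inner (L (time n.+1) w - L (time n) w) (sphYi R i).
have FS := filtration_mono HF (time0 n) (timeS n).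
have mW : sigma_measurable (F (time n.+1)) dW.
  have -> : dW = fun w => L2_inner (L (time n.+1) w) (sphYi R i) -
      L2_inner (L (time n) w) (sphYi R i).
    by apply/funext => w; rewrite /dW L2_innerBl.
  apply: measurable_funB; first exact: (levy_coord_adapted Y1 HL).
  exact: sigma_measurableW FS (levy_coord_adapted Y1 HL (time0 n)).
have W2 : dW \in Lfun P 2%:E by exact: (levy_increment_Lfun Y1 HF HL HQ).
have {}mv := sigma_measurableW FS mv; have {}ma := sigma_measurableW FS ma.
have m_lin (c s : R) : sigma_measurable (F (time n.+1))
    (fun w => c * wave_amplitude i (u n w) + s * (wave_velocity i (u n w) + dW w)).
  apply: measurable_funD; apply: measurable_funM => //; exact: measurable_funD.
have L_lin (c s : R) : (fun w => c * wave_amplitude i (u n w) +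
    s * (wave_velocity i (u n w) + dW w)) \in Lfun P 2%:E.
  by apply: (rpredD (Lfun2Z c a2n) (Lfun2Z s (rpredD v2n W2))); rewrite lee1n.
set t := tau * Num.sqrt (eigenvalue R l).
have aE w : wave_amplitude i (u n.+1 w) = cos t * wave_amplitude i (u n w) +
    sin t * (wave_velocity i (u n w) + dW w).
  exact: trig_step_amplitude.
have vE w : wave_velocity i (u n.+1 w) = - sin t * wave_amplitude i (u n w) +
    cos t * (wave_velocity i (u n w) + dW w).
  exact: trig_step_velocity.
by rewrite (funext aE) (funext vE).
Qed.

Lemma mode_energy_integrable n :
  (fun w => wave_velocity i (u n w) ^+ 2 + wave_amplitude i (u n w) ^+ 2)
    \in Lfun P 1.
Proof.
have [_ _ v2n a2n] := mode_adapted n.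
by apply: rpredD (Lfun2M v2n v2n) (Lfun2M a2n a2n).
Qed.

(** The velocity at time n tau is known before the increment that it
    multiplies in the cross term. *)
Lemma expected_mode_energy n :
  ('E_P[fun w => (wave_velocity i (u n w) ^+ 2 + wave_amplitude i (u n w) ^+ 2)%R] =
   'E_P[fun w => (wave_velocity i (u 0 w) ^+ 2 + wave_amplitude i (u 0 w) ^+ 2)%R] +
   (time n * L2_inner (Q (sphYi R i)) (sphYi R i))%:E)%E.
Proof.
elim: n => [|n IHn]; first by rewrite !mul0r adde0.
have [mv _ v2n _] := mode_adapted n.
have W2 := levy_increment_Lfun Y1 HF HL HQ (time0 n) (timeS n).
rewrite (_ : (fun w => _) =
  ((fun w => wave_velocity i (u n w) ^+ 2 + wave_amplitude i (u n w) ^+ 2) \+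
   (fun w => (2 * wave_velocity i (u n w)) *
     L2_inner (L (time n.+1) w - L (time n) w) (sphYi R i))) \+
   (fun w => L2_inner (L (time n.+1) w - L (time n) w) (sphYi R i) ^+ 2));
  last first.
  by apply/funext => w; rewrite /= -mulrA; exact: trig_step_mode_energy.
have E1 := mode_energy_integrable n.
have E2 := Lfun2M (Lfun2Z 2 v2n) W2.
have E3 := Lfun2M W2 W2.
rewrite expectationD//; last exact: rpredD.
rewrite expectationD// IHn.
rewrite (levy_increment_variance Y1 HF HL HL_mean HQ (time0 n) (timeS n)).
rewrite (levy_increment_orthogonal Y1 HF HL HL_mean HQ (time0 n) (timeS n)) ?adde0.
- by rewrite -addeA -EFinD -mulrDl subrKC.
- by apply: measurable_funM.
- exact: Lfun2Z.
Qed.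
End mode_dynamics.

(** * Expected total energy *)

Section expected_energy.
Context (R : realType) (dO : measure_display) (Omega : measurableType dO)
  (P : probability Omega R) (kappa : nat).
Local Notation L2S2 := (L2 (@surface R)).

Lemma expected_discrete_energy (u : Omega -> L2S2 * L2S2)
    (m : forall l, 'I_l.*2.+1 -> R) :
  (forall w, projH kappa (u w).2 = (u w).2) ->
  (forall l (i : 'I_l.*2.+1), (l <= kappa)%N ->
    (fun w => wave_velocity i (u w) ^+ 2 + wave_amplitude i (u w) ^+ 2)
      \in Lfun P 1) ->
  (forall l (i : 'I_l.*2.+1), (l <= kappa)%N ->
    'E_P[fun w => (wave_velocity i (u w) ^+ 2 + wave_amplitude i (u w) ^+ 2)%R]%E =
    (m l i)%:E) ->
  'E_P[fun w => discrete_energy kappa (u w)]%E =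
  (2^-1 * \sum_(l < kappa.+1) \sum_(i < l.*2.+1) m l i)%:E.
Proof.
move=> pu u1 um.
have ok (l : 'I_kappa.+1) : (l <= kappa)%N by rewrite -ltnS.
have inner (l : 'I_kappa.+1) :=
  @expectation_bigsum _ _ _ P _ (index_enum 'I_l.*2.+1) _ (fun i => u1 l i (ok l)).
have [S1 SE] := @expectation_bigsum _ _ _ P _ (index_enum 'I_kappa.+1) _
  (fun l => (inner l).1).
rewrite (_ : (fun w => _) = 2^-1 \o* (fun w => \sum_(l < kappa.+1)
    \sum_(i < l.*2.+1) (wave_velocity i (u w) ^+ 2 + wave_amplitude i (u w) ^+ 2))).
  rewrite expectationZl// EFinM SE -sumEFin; congr (_ * _)%E.
  apply: eq_bigr => l _; rewrite (inner l).2 -sumEFin.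
  by apply: eq_bigr => i _; exact: um.
by apply/funext => w; rewrite /= mulrC; exact: discrete_energyE.
Qed.
End expected_energy.

Theorem proposition7 (R : realType) (d : measure_display)
    (Omega : measurableType d) (P : probability Omega R)
    (F : R -> set_system Omega)
    (v1 v2 : Omega -> L2 (@surface R)) (L : R -> Omega -> L2 (@surface R))
    (Q : {linear L2 (@surface R) -> L2 (@surface R)})
    (kappa : nat) (tau : R)
    (HF : complete_filtration P F)
    (Hv1 : L2_measurable (F 0) v1) (Hv2 : L2_measurable (F 0) v2)
    (Henergy : (\int[P]_w initial_energy (v1 w) (v2 w) < +oo)%E)
    (HL : sq_integrable_levy P F L) (HL_mean : mean_zero P L)
    (HQ_sym : L2_symmetric Q) (HQ_psd : L2_psd Q)
    (HQ_cov : covariance_operator P L Q) (HQ_trace : (L2_trace Q < +oo)%E)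
    (Hkappa : (0 < kappa)%N) (Htau : 0 < tau) :
  forall n : nat,
    ('E_P[fun w => discrete_energy kappa (trig_integrator kappa tau v1 v2 L n w)]
    = 'E_P[fun w =>
         discrete_energy kappa (trig_integrator kappa tau v1 v2 L 0 w)]
       + (n%:R * tau / 2)%:E
         * L2_trace (truncation kappa Q))%E.
Proof.
move=> n; pose u k := trig_integrator kappa tau v1 v2 L k.
pose m0 l (i : 'I_l.*2.+1) := fine ('E_P[fun w =>
  (wave_velocity i (u 0 w) ^+ 2 + wave_amplitude i (u 0 w) ^+ 2)%R])%E.
pose q l (i : 'I_l.*2.+1) := L2_inner (Q (sphYi R i)) (sphYi R i).
have int k l (i : 'I_l.*2.+1) (lk : (l <= kappa)%N) :=
  mode_energy_integrable Htau HF HL HQ_cov Hv1 Hv2 Henergy i lk k.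
have modeE k l (i : 'I_l.*2.+1) (lk : (l <= kappa)%N) :
    'E_P[fun w =>
      (wave_velocity i (u k w) ^+ 2 + wave_amplitude i (u k w) ^+ 2)%R]%E =
    (m0 l i + k%:R * tau * q l i)%:E.
  rewrite (expected_mode_energy Htau HF HL HL_mean HQ_cov Hv1 Hv2 Henergy i lk).
  by rewrite EFinD fineK// expectation_fin_num// int.
have energyE k := expected_discrete_energy
  (fun w => trig_integrator_projH kappa tau v1 v2 L k w) (int k) (modeE k).
have combine (a b t : \bar R) (x y s z : R) : a = x%:E -> b = y%:E -> t = z%:E ->
    x = y + s * z -> (a = b + s%:E * t)%E by move=> -> -> -> ->.
apply: (combine _ _ _ _ _ _ _ (energyE n) (energyE 0%N) (truncation_trace kappa Q)).
have split k :
    \sum_(l < kappa.+1) \sum_(i < l.*2.+1) (m0 l i + k%:R * tau * q l i) =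
    \sum_(l < kappa.+1) \sum_(i < l.*2.+1) m0 l i +
    k%:R * tau * \sum_(l < kappa.+1) \sum_(i < l.*2.+1) q l i.
  rewrite mulr_sumr -big_split; apply: eq_bigr => l _ /=.
  by rewrite mulr_sumr -big_split.
by rewrite !split; ring.
Qed.
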